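(* Let $G$ be a 3-edge-connected graph with $n$ vertices and $m$ edges. Then a topological extension sequence for $G$ exists, and can be constructed in time $O(mn)$.
   Context: Graphs may have loops and parallel edges. A graph is 3-edge-connected if it is connected and remains connected after deleting any set of at most two edges. For graphs $H,G$ we write $H\xrightarrow{e}G$ and say $G$ is a topological one-edge extension of $H$ if $G$ is obtained from $H$ by one of: (A) adding a new edge $e$ between existing, possibly equal, vertices $a,b$ of $H$; (B) dividing an edge $f$ of $H$ into two edges $f_1,f_2$ by a new vertex $a$ and adding a new edge $e$ between $a$ and an existing vertex $b$ of $H$; (C) dividing two distinct edges $f,g$ of $H$ into $f_1,f_2$ and $g_1,g_2$ by new vertices $a$ and $b$ respectively, and adding a new edge $e$ between $a$ and $b$. A topological extension sequence for $G$ is a sequence $G_0\xrightarrow{e_1}G_1\xrightarrow{e_2}\cdots\xrightarrow{e_k}G_k=G$ where $G_0$ is the graph with a single vertex and no edges. Computational model: the graph is given as an ordered adjacency list (vertices totally ordered), so inspecting the edges at a vertex $v$ takes time $O(\deg v)$ and all edges time $O(m)$. *)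

(* Defs.v *)
From mathcomp Require Import all_boot finmap.

Set Implicit Arguments.
Unset Strict Implicit.
Unset Printing Implicit Defensive.

Local Open Scope fset_scope.
Local Open Scope fmap_scope.

(* Vertices and edges are named by natural numbers.  An edge is mapped to its
   set of ends, which has one element (loop) or two; distinct names may have
   the same ends (parallel edges). *)
Record graph := Graph {
  vset : {fset nat};
  ends : {fmap nat -> {fset nat}};
  ends_wf : [forall e : domf ends,
               (ends e `<=` vset) && (0 < #|` ends e| <= 2)] }.

Definition eset (G : graph) : {fset nat} := domf (ends G).

Definition joins (G : graph) (e u v : nat) : bool :=
  (ends G).[? e] == Some [fset u; v].

Definition adjacent (G : graph) : rel nat :=
  fun u v => has (fun e => joins G e u v) (eset G).

Definition connected (G : graph) : Prop :=
  vset G != fset0 /\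
  forall u v : nat, u \in vset G -> v \in vset G ->
    exists2 p, path (adjacent G) u p & last u p = v.

Lemma del_edges_wf (G : graph) (D : {fset nat}) :
  [forall e : domf (ends G).[\ D],
     ((ends G).[\ D] e `<=` vset G) && (0 < #|` (ends G).[\ D] e| <= 2)].
Proof.
apply/forallP => -[e eD].
have eG : e \in ends G by move: eD; rewrite mem_remf => /andP[].
rewrite (getf_restrict eG eD).
exact: (forallP (ends_wf G) [` eG]).
Qed.

Definition del_edges (G : graph) (D : {fset nat}) : graph :=
  Graph (del_edges_wf G D).

Definition three_edge_connected (G : graph) : Prop :=
  connected G /\
  forall D : {fset nat}, D `<=` eset G -> #|` D| <= 2 ->
    connected (del_edges G D).

Definition add_edge (e a b : nat) (H G : graph) : Prop :=
  [/\ a \in vset H, b \in vset H, e \notin eset H,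
      vset G = vset H & ends G = (ends H).[e <- [fset a; b]]].

(* The edge [f] between [x] and [y] becomes [f1] between [x] and [a] and [f2]
   between [a] and [y].  As [f] disappears, its name may be used again. *)
Definition divide (f x y f1 f2 a : nat) (H G : graph) : Prop :=
  [/\ joins H f x y, a \notin vset H,
      [&& f1 != f2, f1 \notin eset H `\ f & f2 \notin eset H `\ f],
      vset G = a |` vset H &
      ends G = (ends H).[~ f].[f1 <- [fset x; a]].[f2 <- [fset a; y]]].

Inductive extension :=
| ExtA (e a b : nat)
| ExtB (f x y f1 f2 a e b : nat)
| ExtC (f x y f1 f2 a g z w g1 g2 b e : nat).

Definition one_edge_extension (H : graph) (o : extension) (G : graph) : Prop :=
  match o with
  | ExtA e a b => add_edge e a b H G
  | ExtB f x y f1 f2 a e b =>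
      b \in vset H /\
      exists2 H1, divide f x y f1 f2 a H H1 & add_edge e a b H1 G
  | ExtC f x y f1 f2 a g z w g1 g2 b e =>
      (g \in eset H /\ g != f) /\
      exists H1 H2, [/\ divide f x y f1 f2 a H H1,
                        divide g z w g1 g2 b H1 H2 & add_edge e a b H2 G]
  end.

Fixpoint extension_chain (H : graph) (s : seq (extension * graph)) : Prop :=
  if s is (o, H') :: s' then
    one_edge_extension H o H' /\ extension_chain H' s'
  else True.

Definition topological_extension_sequence
    (v0 : nat) (G0 : graph) (s : seq (extension * graph)) (G : graph) : Prop :=
  [/\ vset G0 = [fset v0], eset G0 = fset0,
      extension_chain G0 s & last G0 (unzip2 s) = G].

(* Registers and arrays hold natural numbers; the output is write-only.  An
   instruction or a test takes one unit of time: the expressions occurring in a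
   fixed program have bounded size.  The only arithmetic is successor and
   predecessor, so that in time [t] no value grows by more than [O(t)], and
   unit cost is not a way of computing with long words. *)
Inductive expr :=
| Const (k : nat)
| Reg (x : nat)
| Get (a : nat) (i : expr)
| Succ (e : expr)
| Pred (e : expr).

Inductive test :=
| TestEq (e1 e2 : expr)
| TestLt (e1 e2 : expr)
| TestNot (b : test)
| TestAnd (b1 b2 : test).

Inductive cmd :=
| Skip
| Assign (x : nat) (e : expr)
| Store (a : nat) (i e : expr)
| Output (e : expr)
| Seq (c1 c2 : cmd)
| If (b : test) (c1 c2 : cmd)
| While (b : test) (c : cmd).

Record state := State {
  reg : nat -> nat;
  arr : nat -> nat -> nat;
  out : seq nat }.

Fixpoint eval (s : state) (e : expr) : nat :=
  match e with
  | Const k => k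
  | Reg x => reg s x
  | Get a i => arr s a (eval s i)
  | Succ e => (eval s e).+1
  | Pred e => (eval s e).-1
  end.

Fixpoint holds (s : state) (b : test) : bool :=
  match b with
  | TestEq e1 e2 => eval s e1 == eval s e2
  | TestLt e1 e2 => eval s e1 < eval s e2
  | TestNot b => ~~ holds s b
  | TestAnd b1 b2 => holds s b1 && holds s b2
  end.

Definition set_reg (s : state) (x k : nat) : state :=
  State (fun y => if y == x then k else reg s y) (arr s) (out s).

Definition set_arr (s : state) (a i k : nat) : state :=
  State (reg s)
        (fun a' i' => if (a' == a) && (i' == i) then k else arr s a' i')
        (out s).

Definition emit (s : state) (k : nat) : state :=
  State (reg s) (arr s) (rcons (out s) k).

(* [exec c s t s']: started in [s], [c] halts in [s'] after [t] units. *)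
Inductive exec : cmd -> state -> nat -> state -> Prop :=
| ExecSkip s : exec Skip s 1 s
| ExecAssign x e s : exec (Assign x e) s 1 (set_reg s x (eval s e))
| ExecStore a i e s :
    exec (Store a i e) s 1 (set_arr s a (eval s i) (eval s e))
| ExecOutput e s : exec (Output e) s 1 (emit s (eval s e))
| ExecSeq c1 c2 s s1 s2 t1 t2 :
    exec c1 s t1 s1 -> exec c2 s1 t2 s2 -> exec (Seq c1 c2) s (t1 + t2) s2
| ExecIf b c1 c2 s s' t :
    exec (if holds s b then c1 else c2) s t s' -> exec (If b c1 c2) s t.+1 s'
| ExecWhileTrue b c s s1 s2 t1 t2 :
    holds s b -> exec c s t1 s1 -> exec (While b c) s1 t2 s2 ->
    exec (While b c) s (t1 + t2).+1 s2
| ExecWhileFalse b c s : ~~ holds s b -> exec (While b c) s 1 s.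

Definition adjacency_list := seq (nat * seq (nat * nat)).

(* The vertices are listed once each, in an arbitrary order; the list of [v]
   has one entry [(e, w)] for every edge [e] between [v] and [w] (so that a
   loop is listed once). *)
Definition adjacency_list_of (G : graph) (L : adjacency_list) : Prop :=
  [/\ uniq (unzip1 L), unzip1 L =i vset G &
      forall (v : nat) (l : seq (nat * nat)), (v, l) \in L ->
        uniq l /\ forall e w : nat, ((e, w) \in l) = joins G e v w].

(* Register 0 holds the number of vertices and array 0 the vertices in order.
   The entries of all the lists are stored one list after the other, edges in
   array 2 and neighbours in array 3; those of the [i]-th vertex are at the
   positions [p] with [arr 1 i <= p < arr 1 i.+1].  Everything else is 0. *)
Definition input_state (L : adjacency_list) : state :=
  let lists := unzip2 L in
  let entries := flatten lists in
  {| reg := fun x => if x == 0 then size L else 0;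
     arr := fun a =>
       match a with
       | 0 => nth 0 (unzip1 L)
       | 1 => nth 0 (mkseq (fun i => sumn (take i (shape lists))) (size L).+1)
       | 2 => nth 0 (unzip1 entries)
       | 3 => nth 0 (unzip2 entries)
       | _ => fun => 0
       end;
     out := [::] |}.

Definition extension_code (o : extension) : seq nat :=
  match o with
  | ExtA e a b => [:: 0; e; a; b]
  | ExtB f x y f1 f2 a e b => [:: 1; f; x; y; f1; f2; a; e; b]
  | ExtC f x y f1 f2 a g z w g1 g2 b e =>
      [:: 2; f; x; y; f1; f2; a; g; z; w; g1; g2; b; e]
  end.

(* The graphs are determined by the first one and the successive operations;
   listing all of them in full could take more than [O(m * n)] symbols. *)
Definition sequence_code (v0 : nat) (s : seq (extension * graph)) : seq nat :=
  v0 :: flatten (map extension_code (unzip1 s)).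

(* Main.v *)
(* Let T be a spanning tree of G.  The algorithm maintains a subgraph S of G that
   is a subdivision of the current graph H: the edges of H are the "links" of S.
   If some link has interior vertices, let X consist of them and of the vertices
   hanging from them, that is, those whose T-path towards the root first meets S
   in the interior of this link.  Besides the two end edges of the link, an edge
   uv leaves X by 3-edge-connectivity; with the T-paths from u and v up to S it
   forms an ear from the interior of the link to a vertex outside it, hence a step
   (B) or (C).  If no link has interior vertices but S misses a vertex w, the
   vertices hanging below the same edge of T as w are left by another edge, which
   gives an ear between vertices of H, hence a step (A).  Each such ear adds a
   vertex to S or to H, so that 2n ears suffice; the remaining edges are added by
   steps (A).  A good edge uv is found by one scan of all the edges once the points
   where the T-paths meet S have been computed in tree order, so that an ear
   costs time O(m + n). *)

Require Import Defs.
From mathcomp Require Import all_boot finmap zify.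

Set Implicit Arguments.
Unset Strict Implicit.
Unset Printing Implicit Defensive.

Local Open Scope fset_scope.
Local Open Scope fmap_scope.
Local Open Scope nat_scope.

(** * Edges and cuts *)

(** The sequence has to end in [G] itself, not in an isomorphic copy, so the edge names must come
    out right. This is why a link is named by its first edge in [G]: dividing it at [a] gives halves
    named by the old name and by the edge after [a], and once no link has interior vertices, H is a
    subgraph of [G] with the same names. An ear is traced from its middle edge uv outwards, but its
    first edge is known in advance: it is uv if [u] is in S, and otherwise the tree edge of the last
    vertex outside S on the path from [u]. Hence a step can be output before its ear is traced. Ends
    of the ear that are interior to links are made vertices of H by divisions beforehand, so that
    tracing is the same for the three kinds of step. Termination and time are read off the syntax:
    every loop makes n passes, or one pass per entry of the lists, of which there are at most 2m.
    Loops may be longer than needed, as a walk up the tree is idle once it has reached S. *)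

Lemma fset2_eq (u v x y : nat) :
  [fset u; v] = [fset x; y] -> (u = x /\ v = y) \/ (u = y /\ v = x).
Proof.
move/fsetP => E; move: (E u) (E v) (E x) (E y); rewrite !inE !eqxx !orbT /=.
lia.
Qed.

Section Joins.
Variable G : graph.

Lemma joinsC e u v : joins G e u v -> joins G e v u.
Proof. by rewrite /joins fsetUC. Qed.

Lemma joins_uniq e u v x y : joins G e u v -> joins G e x y ->
  (u = x /\ v = y) \/ (u = y /\ v = x).
Proof. by move=> /eqP E1 /eqP; rewrite E1 => -[/fset2_eq]. Qed.

Lemma joins_inj e u v w : joins G e u v -> joins G e u w -> v = w.
Proof. by move=> j1 j2; case: (joins_uniq j1 j2); lia. Qed.

Lemma joins_eset e u v : joins G e u v -> e \in eset G.
Proof. by move=> /eqP; rewrite /eset -fndSome => ->. Qed.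

Lemma joins_vset e u v : joins G e u v -> u \in vset G /\ v \in vset G.
Proof.
move=> j; have eG := joins_eset j; move/eqP: j.
rewrite (in_fnd eG) => -[E].
have /andP[/fsubsetP sub _] := forallP (ends_wf G) [` eG].
by split; apply: sub; rewrite E !inE eqxx ?orbT.
Qed.

Lemma eset_joins e : e \in eset G -> exists u v, joins G e u v.
Proof.
move=> eG; have /andP[_] := forallP (ends_wf G) [` eG].
rewrite /joins (in_fnd eG); move: (ends G _) => s {eG} /andP[c0 c2].
have [u us] : exists u, u \in s by apply/fset0Pn; rewrite -cardfs_gt0.
have [/eqP E|/fset0Pn[v]] := boolP (s `\ u == fset0).
  exists u, u; apply/eqP; congr Some; rewrite fsetUid.
  apply/fsetP => w; move/fsetP/(_ w): E; rewrite !inE.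
  by case: eqP => [->|//]; rewrite us.
rewrite !inE => /andP[vu vs].
exists u, v; apply/eqP; congr Some; apply/eqP; rewrite eq_sym eqEfcard.
rewrite cardfs2 eq_sym vu c2 andbT.
by apply/fsubsetP => w; rewrite !inE => /orP[]/eqP->.
Qed.

(** On a path from [u] to [v] that avoids [D], the first edge that leaves [X] will do. This is the
    only place where edges are deleted. *)
Lemma crossing_edge (X D : {fset nat}) u v :
  three_edge_connected G -> D `<=` eset G -> #|` D| <= 2 ->
  u \in vset G -> u \in X -> v \in vset G -> v \notin X ->
  exists e x y, [/\ joins G e x y, e \notin D, x \in X & y \notin X].
Proof.
move=> [_ c3] sD cD uG uX vG vX.
have [_ /(_ u v uG vG)[p]] := c3 _ sD cD.
elim: p u {uG} uX => [|w p IH] u uX /=; first by move=> _ E; rewrite -E uX in vX.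
move=> /andP[/hasP[e eS j] pp] lp.
have [wX|wX] := boolP (w \in X); first exact: (IH w).
exists e, u, w; split => //.
  move: j; rewrite /joins /del_edges /= fnd_restrict.
  by case: ifP.
move: eS; rewrite /eset /= mem_remf.
by case/andP.
Qed.

End Joins.

Lemma exists_add_edge (e a b : nat) (H : graph) :
  a \in vset H -> b \in vset H -> e \notin eset H ->
  exists G, add_edge e a b H G.
Proof.
move=> aH bH eH.
have wf : [forall g : domf (ends H).[e <- [fset a; b]],
  ((ends H).[e <- [fset a; b]] g `<=` vset H)
    && (0 < #|` (ends H).[e <- [fset a; b]] g| <= 2)].
  apply/forallP => -[g gD].
  have := gD; rewrite mem_setf => /=.
  have E : (ends H).[e <- [fset a; b]].[? g] =
    Some ((ends H).[e <- [fset a; b]] [` gD]) by rewrite in_fnd.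
  move: E; rewrite fnd_set; case: eqP => [_ [<-] _|_].
    apply/andP; split; last by rewrite cardfs2; case: eqP.
    by apply/fsubsetP => w; rewrite !inE => /orP[]/eqP->.
  move=> E _; have gH : g \in ends H by rewrite -fndSome E.
  move: E; rewrite (in_fnd gH) => -[<-].
  exact: (forallP (ends_wf H) [` gH]).
by exists (Graph wf); split.
Qed.

Lemma exists_divide (f x y f1 f2 a : nat) (H : graph) :
  joins H f x y -> a \notin vset H ->
  [&& f1 != f2, f1 \notin eset H `\ f & f2 \notin eset H `\ f] ->
  exists G, divide f x y f1 f2 a H G.
Proof.
move=> j aH nm; have [xH yH] := joins_vset j.
set E := (ends H).[~ f].[f1 <- [fset x; a]].[f2 <- [fset a; y]].
have wf : [forall g : domf E,
  (E g `<=` a |` vset H) && (0 < #|` E g| <= 2)].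
  apply/forallP => -[g gD].
  have Eg : E.[? g] = Some (E [` gD]) by rewrite in_fnd.
  move: Eg; rewrite {1}/E !fnd_set; case: eqP => [_ [<-]|_].
    apply/andP; split; last by rewrite cardfs2; case: eqP.
    by apply/fsubsetP => w; rewrite !inE => /orP[]/eqP->; rewrite ?eqxx ?yH ?orbT.
  case: eqP => [_ [<-]|_].
    apply/andP; split; last by rewrite cardfs2; case: eqP.
    by apply/fsubsetP => w; rewrite !inE => /orP[]/eqP->; rewrite ?eqxx ?xH ?orbT.
  rewrite fnd_rem1; case: eqP => //= _ Eg.
  have gH : g \in ends H by rewrite -fndSome Eg.
  move: Eg; rewrite (in_fnd gH) => -[<-].
  have /andP[sub ->] := forallP (ends_wf H) [` gH].
  by rewrite andbT; apply: fsubset_trans sub _; exact: fsubsetUr.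
by exists (Graph wf); split.
Qed.

(** * Subdivisions *)

(** The effect of one store on an array: for a numeral [a], [arr (set_arr s a i k) a] reduces to
    [upd (arr s a) i k]. *)
Definition upd (f : nat -> nat) (i k : nat) : nat -> nat :=
  fun j => if j == i then k else f j.

Section Subdivision.
Variables (G : graph) (pe : nat -> nat).

(* On the link [g], the edge [e] leads from [u], which has position [q], to the
   next vertex of the link. *)
Definition next_on_link (lab pos dst : nat -> nat) (g e u q : nat) : Prop :=
  exists2 h, joins G e u h &
    [/\ lab h = g.+2, q < pos h &
        forall b, lab b = g.+2 -> q < pos b -> pos h <= pos b]
    \/ (h = dst g /\ forall b, lab b = g.+2 -> pos b <= q).

(* [lab v] is 0 if [v] is not in S, 1 if it is a vertex of H, and [g.+2] if it is
   interior to the link [g]; then [pos v] increases along the link, starting from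
   above 0, and [nxt v] is the edge of the link that follows [v].  A link is named
   by its first edge: this is [fst g], which differs from [g] only while the ear
   [g] is being built.  [es e] is 0 if [e] is not in S, 1 if [e] is the first edge
   of a link, and [a.+2] if [e = nxt a].  [pe v] is the tree edge from [v] to its
   parent. *)
Record subdivision (lab pos nxt src dst es : nat -> nat) (Lk : {fset nat})
    (fst : nat -> nat) : Prop := Subdivision {
  sub_vset : forall w, lab w != 0 -> w \in vset G;
  sub_interior : forall a g, lab a = g.+2 ->
    [/\ g \in Lk, 0 < pos a, next_on_link lab pos dst g (nxt a) a (pos a) &
        es (nxt a) = a.+2];
  sub_link : forall g, g \in Lk ->
    next_on_link lab pos dst g (fst g) (src g) 0 /\ es (fst g) = 1;
  sub_pos : forall a b g, lab a = g.+2 -> lab b = g.+2 -> pos a = pos b -> a = b;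
  sub_es1 : forall e, es e = 1 -> exists2 g, g \in Lk & fst g = e;
  sub_fst : forall g h, g \in Lk -> h \in Lk -> fst g = fst h -> g = h;
  sub_es2 : forall e a, es e = a.+2 -> 1 < lab a /\ nxt a = e;
  sub_tree : forall w, w \in vset G -> lab w = 0 -> es (pe w) = 0 }.

Lemma next_on_link_ext lab pos dst lab' pos' dst' g e u q :
  (forall b, lab' b = g.+2 <-> lab b = g.+2) ->
  (forall b, lab b = g.+2 -> pos' b = pos b) -> dst' g = dst g ->
  next_on_link lab pos dst g e u q -> next_on_link lab' pos' dst' g e u q.
Proof.
move=> El Ep Ed [h j H]; exists h => //; case: H => [[lh ph mh]|[hd mh]].
  left; split; [exact/El | by rewrite Ep | move=> b /El lb].
  by rewrite !Ep //; exact: mh.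
by right; rewrite Ed; split=> // b /El lb; rewrite Ep //; apply: mh.
Qed.

Section Steps.
Variables (lab pos nxt src dst es : nat -> nat) (Lk : {fset nat}).
Variable fst : nat -> nat.
Hypothesis S : subdivision lab pos nxt src dst es Lk fst.

(** Spares functional extensionality: [fst] arises as an iterated [upd] that agrees only pointwise
    with the function wanted. *)
Lemma subdivision_ext fst' : fst' =1 fst ->
  subdivision lab pos nxt src dst es Lk fst'.
Proof.
move=> E; case: S => ? ? link ? es1 inj ? ?; split => //.
- by move=> g gL; rewrite E; apply: link.
- by move=> e /es1[g gL <-]; exists g.
- by move=> g h gL hL; rewrite !E; apply: inj.
Qed.

Lemma grow_src f p d :
  f \in Lk -> lab (src f) = 0 -> src f \in vset G ->
  joins G (pe (src f)) (src f) p -> 0 < d ->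
  (forall b, lab b = f.+2 -> d < pos b) ->
  (forall w, w \in vset G -> lab w = 0 -> pe w = pe (src f) -> w = src f) ->
  subdivision (upd lab (src f) f.+2) (upd pos (src f) d)
    (upd nxt (src f) (fst f)) (upd src f p) dst
    (upd (upd es (fst f) (src f).+2) (pe (src f)) 1) Lk
    (upd fst f (pe (src f))).
Proof.
move=> fL; set c := src f => lc cG jc d0 dm pei.
have esc : es (pe c) = 0 by apply: (sub_tree S).
have [nf esf] := sub_link S fL.
have nef : pe c <> fst f by move=> E; rewrite E esf in esc.
have fresh g : g <> f -> forall e u q, next_on_link lab pos dst g e u q ->
  next_on_link (upd lab c f.+2) (upd pos c d) dst g e u q.
  move=> gf e u q; apply: next_on_link_ext => // b; rewrite /upd;
    case: eqP => // ->; rewrite lc //; lia.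
have old e u q : d <= q -> next_on_link lab pos dst f e u q ->
  next_on_link (upd lab c f.+2) (upd pos c d) dst f e u q.
  move=> dq [h j [[lh ph mh]|[hd mh]]]; exists h => //.
    have hc : h <> c by move=> E; rewrite E lc in lh.
    left; rewrite /upd; move/eqP/negbTE: (hc) => ->; split=> // b.
    by case: eqP => [_ _|_]; [lia | apply: mh].
  right; split => // b; rewrite /upd; case: eqP => [_ _|_]; [lia | exact: mh].
split.
- by move=> w; rewrite /upd; have [-> //|_] := eqVneq w c; exact: (sub_vset S).
- move=> a g; rewrite {1}/upd; case: eqP => [-> [<-]|ac la].
    have E k : upd k c d c = d by rewrite /upd eqxx.
    have E' k : upd k c (fst f) c = fst f by rewrite /upd eqxx.
    rewrite E E'; split => //; last first.
      by rewrite /upd eqxx; case: eqP => // E1; case: nef.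
    case: nf => h j; rewrite -/c in j * => -[[lh ph mh]|[hd mh]]; exists h => //.
      have hc : h <> c by move=> E1; rewrite E1 lc in lh.
      left; rewrite /upd; move/eqP/negbTE: (hc) => ->; split=> //; first exact: dm.
      by move=> b; case: eqP => [_ _|_ lb db]; [lia | apply: mh => //; lia].
    right; split => // b; rewrite /upd; case: eqP => // _ lb.
    by have := mh _ lb; have := dm _ lb; lia.
  have [gL pa na ea] := sub_interior S la.
  have E k i : upd k c i a = k a by rewrite /upd; case: eqP.
  rewrite !E; split => //.
    case: (g =P f) => [gf|gf]; last exact: fresh.
    by rewrite gf; apply: old; [rewrite gf in la; have := dm _ la; lia|rewrite -gf].
  rewrite /upd; case: eqP => [E1|_]; first by rewrite E1 esc in ea.
  by case: eqP => [E1|//]; rewrite E1 esf in ea.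
- move=> g gL; case: (g =P f) => [->|gf].
    rewrite /upd !eqxx; split=> //.
    exists c; first exact: joinsC.
    left; rewrite !eqxx; split=> // b; case: eqP => // _ lb _.
    by have := dm _ lb; lia.
  have [ng eg] := sub_link S gL.
  have E k i : upd k f i g = k g by rewrite /upd; case: eqP.
  rewrite !E; split; first exact: fresh.
  rewrite /upd; case: eqP => [//|_]; case: eqP => // E1.
  by case: gf; apply: (sub_fst S).
- move=> a b g; rewrite /upd; case: eqP => [->|ac]; case: eqP => [->|bc] //.
  + by move=> [<-] lb E; have := dm _ lb; lia.
  + by move=> la [E]; rewrite -E in la => E'; have := dm _ la; lia.
  + exact: (sub_pos S).
- move=> e; rewrite /upd; case: eqP => [-> _|E1]; first by exists f => //; rewrite eqxx.
  case: eqP => // E2 /(sub_es1 S)[g gL E3]; exists g => //.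
  by case: eqP => // E4; case: E2; rewrite -E3 E4.
- move=> g h gL hL; rewrite /upd; case: eqP => [->|gf]; case: eqP => [->|hf] //.
  + by move=> E; have [_] := sub_link S hL; rewrite -E esc.
  + by move=> E; have [_] := sub_link S gL; rewrite E esc.
  + exact: (sub_fst S).
- move=> e a; rewrite /upd; case: eqP => // E1; case: eqP => [-> [<-]|E2].
    by rewrite eqxx.
  move=> /(sub_es2 S)[la na]; case: eqP => // E3.
  by rewrite E3 lc in la.
- move=> w wG; rewrite /upd; case: eqP => // wc lw.
  case: eqP => [E|_]; first by case: wc; apply: pei.
  have ew := sub_tree S wG lw.
  by case: eqP => [E|//]; rewrite E esf in ew.
Qed.

Lemma grow_dst f p q :
  f \in Lk -> lab (dst f) = 0 -> dst f \in vset G ->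
  joins G (pe (dst f)) (dst f) p -> 0 < q ->
  (forall b, lab b = f.+2 -> pos b < q) ->
  (forall w, w \in vset G -> lab w = 0 -> pe w = pe (dst f) -> w = dst f) ->
  subdivision (upd lab (dst f) f.+2) (upd pos (dst f) q)
    (upd nxt (dst f) (pe (dst f))) src (upd dst f p)
    (upd es (pe (dst f)) (dst f).+2) Lk fst.
Proof.
move=> fL; set c := dst f => lc cG jc q0 qm pei.
have esc : es (pe c) = 0 by apply: (sub_tree S).
have fresh g : g <> f -> forall e u r, next_on_link lab pos dst g e u r ->
  next_on_link (upd lab c f.+2) (upd pos c q) (upd dst f p) g e u r.
  move=> gf e u r; apply: next_on_link_ext => [b|b|]; rewrite /upd;
    case: eqP => // ->; rewrite lc //; lia.
have old e u r : r < q -> next_on_link lab pos dst f e u r ->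
  next_on_link (upd lab c f.+2) (upd pos c q) (upd dst f p) f e u r.
  move=> dq [h j [[lh ph mh]|[hd mh]]]; exists h => //.
    have hc : h <> c by move=> E; rewrite E lc in lh.
    left; rewrite /upd; move/eqP/negbTE: (hc) => ->; split=> // b.
    by case: eqP => [_ _ _|_]; [have := qm _ lh; lia | apply: mh].
  left; rewrite hd /upd eqxx; split => // b; case: eqP => // _ lb.
  by have := mh _ lb; lia.
split.
- by move=> w; rewrite /upd; have [-> //|_] := eqVneq w c; exact: (sub_vset S).
- move=> a g; rewrite {1}/upd; case: eqP => [-> [<-]|ac la].
    have E k i : upd k c i c = i by rewrite /upd eqxx.
    rewrite !E; split=> //; last by rewrite /upd eqxx.
    exists p => //; right; rewrite /upd eqxx; split=> // b.
    by case: eqP => // _ lb; have := qm _ lb; lia.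
  have [gL pa na ea] := sub_interior S la.
  have E k i : upd k c i a = k a by rewrite /upd; case: eqP.
  rewrite !E; split => //.
    case: (g =P f) => [gf|gf]; last exact: fresh.
    by rewrite gf; apply: old; [rewrite gf in la; have := qm _ la; lia|rewrite -gf].
  by rewrite /upd; case: eqP => [E1|_ //]; rewrite E1 esc in ea.
- move=> g gL; have [ng eg] := sub_link S gL; split.
    by case: (g =P f) => [gf|gf]; [rewrite gf; apply: old; rewrite -?gf|exact: fresh].
  by rewrite /upd; case: eqP => [E1|_ //]; rewrite E1 esc in eg.
- move=> a b g; rewrite /upd; case: eqP => [->|ac]; case: eqP => [->|bc] //.
  + by move=> [<-] lb E; have := qm _ lb; lia.
  + by move=> la [E]; rewrite -E in la => E'; have := qm _ la; lia.
  + exact: (sub_pos S).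
- by move=> e; rewrite /upd; case: eqP => // _; exact: (sub_es1 S).
- exact: (sub_fst S).
- move=> e a; rewrite /upd; case: eqP => [-> [<-]|E1]; first by rewrite eqxx.
  move=> /(sub_es2 S)[la na]; case: eqP => // E3.
  by rewrite E3 lc in la.
- move=> w wG; rewrite /upd; case: eqP => // wc lw.
  case: eqP => [E|_]; first by case: wc; apply: pei.
  exact: (sub_tree S).
Qed.

(** The name [f] is the future first edge; it differs from [e] if the source end still has to be
    moved. An edge added between two vertices of H is the case [f = e]. *)
Lemma start_link f e u v :
  fst =1 id -> es e = 0 -> f \notin Lk -> joins G e u v ->
  (forall w, w \in vset G -> lab w = 0 -> pe w <> e) ->
  subdivision lab pos nxt (upd src f u) (upd dst f v) (upd es e 1) (f |` Lk)
    (upd id f e).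
Proof.
move=> fid e0 fL j pee.
have nolab b : lab b <> f.+2.
  by move=> lb; have [] := sub_interior S lb; rewrite (negbTE fL).
have fresh g : g <> f -> forall e u r, next_on_link lab pos dst g e u r ->
  next_on_link lab pos (upd dst f v) g e u r.
  by move=> gf e' u' r; apply: next_on_link_ext => //; rewrite /upd; case: eqP.
split.
- exact: (sub_vset S).
- move=> a g la; have [gL pa na ea] := sub_interior S la.
  rewrite !inE gL orbT; split=> //.
    by apply: fresh => // gf; rewrite gf in gL; case/negP: fL.
  by rewrite /upd; case: eqP => [E1|_ //]; rewrite E1 e0 in ea.
- move=> g; rewrite !inE /upd; case: eqP => [-> _|gf /= gL].
    rewrite !eqxx; split=> //; exists v => //; right; rewrite eqxx.
    by split=> // b /nolab.
  have [ng eg] := sub_link S gL; rewrite fid in ng eg; split; first exact: fresh.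
  by case: eqP => // E; rewrite E e0 in eg.
- exact: (sub_pos S).
- move=> e'; rewrite /upd; case: eqP => [-> _|_ /(sub_es1 S)[g gL E]].
    by exists f; rewrite ?inE eqxx.
  exists g; first by rewrite !inE gL orbT.
  by rewrite -E fid; case: eqP => // E'; rewrite E' (negbTE fL) in gL.
- have nofst g : g \in Lk -> g <> e.
    by move=> gL E; have [_] := sub_link S gL; rewrite fid E e0.
  move=> g h; rewrite !inE /upd; case: eqP => [-> _|gf /= gL];
    case: eqP => [-> _|hf /= hL] //.
  + by move=> E; case: (nofst _ hL).
  + by move=> E; case: (nofst _ gL).
- by move=> e' a; rewrite /upd; case: eqP => // _; exact: (sub_es2 S).
- move=> w wG lw; rewrite /upd; case: eqP => [E|_]; first by case: (pee w).
  exact: (sub_tree S).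
Qed.

(** The first half keeps its first edge, hence the name [g]; the second half begins with [nxt a].
    Positions are only compared within a link, so they remain valid on both halves. *)
Lemma split_link a g lab' : fst =1 id -> lab a = g.+2 ->
  (forall w, lab' w = if w == a then 1 else
     if (lab w == g.+2) && (pos a < pos w) then (nxt a).+2 else lab w) ->
  subdivision lab' pos nxt (upd src (nxt a) a)
    (upd (upd dst (nxt a) (dst g)) g a) (upd es (nxt a) 1) (nxt a |` Lk) id.
Proof.
move=> fid la Elab; have [gL pa na ea] := sub_interior S la.
set f := nxt a in na ea Elab *.
have fL : f \notin Lk.
  by apply/negP => fL; have [_] := sub_link S fL; rewrite fid ea.
have fg : f <> g by move=> E; rewrite E gL in fL.
have nolab b : lab b <> f.+2.
  by move=> lb; have [] := sub_interior S lb; rewrite (negbTE fL).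
have lab_g b : lab' b = g.+2 <-> lab b = g.+2 /\ pos b < pos a.
  rewrite Elab; case: eqP => [->|ba]; first by rewrite la; split=> // -[_]; lia.
  case: eqP => [lb|lb] /=; last by split=> // -[].
  case: ltnP => [|pab]; first by lia.
  rewrite lb; split=> // _; split=> //.
  have : pos b <> pos a by move=> E; apply: ba; apply: (sub_pos S) lb la E.
  lia.
have lab_f b : lab' b = f.+2 <-> lab b = g.+2 /\ pos a < pos b.
  rewrite Elab; case: eqP => [->|ba]; first by rewrite la; split=> // -[_]; lia.
  case: eqP => [lb|lb] /=; last by split=> [/nolab //|[]].
  case: ltnP => [//|pab]; rewrite lb; split; [lia | case; lia].
have lab_h b h : h <> g -> h <> f -> lab' b = h.+2 <-> lab b = h.+2.
  move=> hg hf; rewrite Elab; case: eqP => [->|ba].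
    rewrite la; split; lia.
  by case: eqP => [->|//] /=; case: ifP => // _; split; lia.
have fresh h : h <> g -> h <> f -> forall e u r,
  next_on_link lab pos dst h e u r ->
  next_on_link lab' pos (upd (upd dst f (dst g)) g a) h e u r.
  move=> hg hf e u r; apply: next_on_link_ext => // [b|]; first exact: lab_h.
  by rewrite /upd; case: eqP => // _; case: eqP.
have part1 e u r : r < pos a -> next_on_link lab pos dst g e u r ->
  next_on_link lab' pos (upd (upd dst f (dst g)) g a) g e u r.
  move=> ra [h j [[lh rh mh]|[hd mh]]]; last by have := mh a la; lia.
  exists h => //; case: (h =P a) => [E|ha].
    right; rewrite /upd eqxx; split=> // b /lab_g[lb pb].
    by case: leqP => // rb; have := mh _ lb rb; rewrite E; lia.
  left; split=> //.
    have : pos h <> pos a by move=> E; apply: ha; apply: (sub_pos S) lh la E.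
    by move=> E; apply/lab_g; split=> //; have := mh _ la ra; lia.
  by move=> b /lab_g[lb pb]; apply: mh.
have part2 e u r : pos a <= r -> next_on_link lab pos dst g e u r ->
  next_on_link lab' pos (upd (upd dst f (dst g)) g a) f e u r.
  move=> ra [h j [[lh rh mh]|[hd mh]]]; exists h => //.
    left; split=> //; first by apply/lab_f; split=> //; lia.
    by move=> b /lab_f[lb pb]; apply: mh.
  right; split; last by move=> b /lab_f[lb pb]; apply: mh.
  by rewrite /upd; case: eqP => // _; rewrite eqxx.
(* As the source of the second half, [a] counts as position 0. All vertices of this half are beyond
   [pos a], so none is skipped. *)
have part3 e u : next_on_link lab pos dst g e u (pos a) ->
  next_on_link lab' pos (upd (upd dst f (dst g)) g a) f e u 0.
  move=> /(part2 _ _ _ (leqnn _))[h j [[lh rh mh]|[hd mh]]]; exists h => //.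
    left; split=> //; first by lia.
    by move=> b lb _; apply: mh => //; case/lab_f: lb.
  right; split=> // b lb; have := mh _ lb; case/lab_f: lb; lia.
split.
- move=> w; rewrite Elab; have [-> _|_] := eqVneq w a.
    by apply: (sub_vset S); rewrite la.
  have [lw _|_] := eqVneq (lab w) g.+2; first by apply: (sub_vset S); rewrite lw.
  exact: (sub_vset S).
- move=> b h; case: (h =P g) => [->|hg].
    move=> /lab_g[lb pb]; have [_ pb0 nb eb] := sub_interior S lb.
    rewrite !inE gL orbT; split=> //; first exact: part1.
    rewrite /upd; case: eqP => // E; move: eb; rewrite E ea => -[E'].
    by move: pb; rewrite E' ltnn.
  case: (h =P f) => [->|hf].
    move=> /lab_f[lb pb]; have [_ pb0 nb eb] := sub_interior S lb.
    rewrite !inE eqxx; split=> //; first by apply: part2 => //; lia.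
    rewrite /upd; case: eqP => // E; move: eb; rewrite E ea => -[E'].
    by move: pb; rewrite E' ltnn.
  move=> /(lab_h _ _ hg hf) lb; have [hL pb0 nb eb] := sub_interior S lb.
  rewrite !inE hL orbT; split=> //; first exact: fresh.
  rewrite /upd; case: eqP => // E; move: eb; rewrite E ea => -[E'].
  by case: hg; rewrite -E' la in lb; case: lb.
- move=> h; rewrite !inE; case: eqP => [-> _|hf /= hL].
    rewrite {1 3}/upd eqxx; split; last by rewrite /upd eqxx.
    exact: part3.
  have [nh eh] := sub_link S hL; rewrite fid in nh eh.
  split; last by rewrite /upd; case: eqP.
  have -> : upd src f a h = src h by rewrite /upd; case: eqP.
  case: (h =P g) => [E|hg]; last exact: fresh.
  by rewrite E in nh *; apply: part1.
- move=> b c h; case: (h =P g) => [->|hg].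
    by move=> /lab_g[lb _] /lab_g[lc _]; apply: (sub_pos S) lb lc.
  case: (h =P f) => [->|hf].
    by move=> /lab_f[lb _] /lab_f[lc _]; apply: (sub_pos S) lb lc.
  by move=> /(lab_h _ _ hg hf) lb /(lab_h _ _ hg hf); apply: (sub_pos S) lb.
- move=> e; rewrite /upd; case: eqP => [-> _|_ /(sub_es1 S)[h hL <-]].
    by exists f; rewrite // !inE eqxx.
  by exists h; rewrite ?fid // !inE hL orbT.
- by [].
- move=> e b; rewrite /upd; case: eqP => // ef /(sub_es2 S)[lb nb]; split=> //.
  rewrite Elab; case: eqP => [E|_]; first by case: ef; rewrite -nb E.
  by case: ifP.
- move=> w wG; rewrite Elab; case: eqP => // wa.
  case: eqP => /= [lw|_ lw]; first by case: ifP; rewrite ?lw.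
  have ew := sub_tree S wG lw.
  by rewrite /upd; case: eqP => // E; rewrite E ea in ew.
Qed.

End Steps.
End Subdivision.

(** * Good edges *)

(** Acyclicity is expressed by a numbering that decreases towards the root; it is also the measure
    for inductions along tree paths. *)
Record spanning_tree (G : graph) (root : nat) (par pe idx : nat -> nat) : Prop :=
  SpanningTree {
  tree_root : root \in vset G;
  tree_idx : forall w, w \in vset G -> 0 < idx w;
  tree_edge : forall w, w \in vset G -> w != root ->
    joins G (pe w) w (par w) /\ idx (par w) < idx w }.

(* [top w] is the last vertex outside S on the tree path from [w] to the root (or
   [w] if it is in S), and [rr w] the first vertex in S. *)
Definition hanging (lab par top rr : nat -> nat) (w : nat) : Prop :=
  if lab w == 0 then
    if lab (par w) == 0 then top w = top (par w) /\ rr w = rr (par w)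
    else top w = w /\ rr w = par w
  else top w = w /\ rr w = w.

(* Since the paths from [u] and [v] to S do not meet unless [top u = top v], this
   says that they form with [e] an ear that is not in the interior of a single
   link, and that adds a vertex to S or to H. *)
Definition good_edge (lab es pe top rr : nat -> nat) (e u v : nat) : bool :=
  [&& es e == 0, ~~ ((lab u == 0) && (pe u == e)),
      ~~ ((lab v == 0) && (pe v == e)), top u != top v &
      (1 < lab (rr u)) && (lab (rr u) != lab (rr v))
      || [&& lab (rr u) == 1, lab (rr v) == 1 & lab u == 0]].

(** The program never stores H; this is how H is read off the arrays. *)
Record model (G : graph) (pe : nat -> nat) (H : graph)
    (lab pos nxt src dst es : nat -> nat) : Prop := Model {
  model_vset : forall v, (v \in vset H) = (lab v == 1);
  model_joins : forall g, g \in eset H -> joins H g (src g) (dst g);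
  model_sub : subdivision G pe lab pos nxt src dst es (eset H) id }.

Section Tree.
Variables (G : graph) (root : nat) (par pe idx : nat -> nat).
Hypothesis T : spanning_tree G root par pe idx.

(** Two distinct vertices with the same tree edge would be each other's parents, against the
    numbering. *)
Lemma tree_edge_inj w w' : w \in vset G -> w' \in vset G ->
  w != root -> w' != root -> pe w = pe w' -> w = w'.
Proof.
move=> wG wG' wr wr' E.
have [j i] := tree_edge T wG wr; have [j' i'] := tree_edge T wG' wr'.
rewrite E in j; case: (joins_uniq j j') => -[E1 E2] //.
by rewrite E2 in i; rewrite -E1 in i'; lia.
Qed.

Section Hanging.
Variables lab top rr : nat -> nat.
Hypothesis lab_root : lab root != 0.
Hypothesis Hg : forall w, w \in vset G -> hanging lab par top rr w.

Lemma unlabelled_root w : lab w = 0 -> w != root.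
Proof. by move=> lw; apply: contraNneq lab_root => <-; rewrite lw. Qed.

Lemma hanging_labelled w : w \in vset G -> lab w != 0 ->
  top w = w /\ rr w = w.
Proof. by move=> /Hg; rewrite /hanging => H /negbTE E; rewrite E in H. Qed.

Lemma hanging_unlabelled w : w \in vset G -> lab w = 0 ->
  [/\ top w \in vset G, lab (top w) = 0, rr w = par (top w) & rr w = rr (par w)].
Proof.
have [k] := ubnP (idx w); elim: k w => // k IH w wk wG lw.
have wr := unlabelled_root lw; have [j i] := tree_edge T wG wr.
have pG := (joins_vset j).2.
have := Hg wG; rewrite /hanging lw eqxx.
have [lp [-> ->]|lp [-> ->]] := eqVneq (lab (par w)) 0.
  have ik : idx (par w) < k by lia.
  by have [? ? ? ?] := IH _ ik pG lp.
by have [_ ->] := hanging_labelled pG lp.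
Qed.

Lemma hanging_rr w : w \in vset G -> rr w \in vset G /\ lab (rr w) != 0.
Proof.
have [k] := ubnP (idx w); elim: k w => // k IH w wk wG.
have [lw|lw] := eqVneq (lab w) 0; last first.
  by have [_ ->] := hanging_labelled wG lw.
have wr := unlabelled_root lw; have [j i] := tree_edge T wG wr.
have pG := (joins_vset j).2; have [_ _ _ ->] := hanging_unlabelled wG lw.
by apply: IH => //; lia.
Qed.

(** Used contrapositively: tree paths that meet S in different vertices are disjoint outside S. *)
Lemma top_rr u v : u \in vset G -> v \in vset G -> top u = top v -> rr u = rr v.
Proof.
move=> uG vG E.
have [lu|lu] := eqVneq (lab u) 0; have [lv|lv] := eqVneq (lab v) 0.
- have [_ _ -> _] := hanging_unlabelled uG lu.
  by have [_ _ -> _] := hanging_unlabelled vG lv; rewrite E.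
- have [_ l0 _ _] := hanging_unlabelled uG lu.
  by have [E' _] := hanging_labelled vG lv; rewrite E E' in l0; rewrite l0 in lv.
- have [_ l0 _ _] := hanging_unlabelled vG lv.
  by have [E' _] := hanging_labelled uG lu; rewrite -E E' in l0; rewrite l0 in lu.
have [E1 E2] := hanging_labelled uG lu; have [E3 E4] := hanging_labelled vG lv.
by rewrite E2 E4 -E3 -E E1.
Qed.

Section Good.
Variable H : graph.
Variables pos nxt src dst es : nat -> nat.
Hypothesis M : model G pe H lab pos nxt src dst es.
Hypothesis G3 : three_edge_connected G.

Lemma link_ends_branch g : g \in eset H -> lab (src g) = 1 /\ lab (dst g) = 1.
Proof.
move=> gH; have [] := joins_vset (model_joins M gH).
by rewrite !(model_vset M) => /eqP -> /eqP.
Qed.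

Lemma used_edge_ends e u v : es e != 0 -> joins G e u v -> lab u != 0.
Proof.
have S := model_sub M.
case E: (es e) => [//|[|a]] _ j.
  have [g gH /= E1] := sub_es1 S E; have [[h j' nh] _] := sub_link S gH.
  have [ls ld] := link_ends_branch gH.
  have lh : lab h != 0 by case: nh => [[-> //]|[-> _]]; rewrite ld.
  by subst g; case: (joins_uniq j j') => -[-> _]; rewrite ?ls.
have [la E1] := sub_es2 S E; case E2: (lab a) la => [//|[//|g]] _.
have [gH pa [h j' nh] _] := sub_interior S E2.
have [ls ld] := link_ends_branch gH.
have lh : lab h != 0 by case: nh => [[-> //]|[-> _]]; rewrite ld.
by rewrite E1 in j'; case: (joins_uniq j j') => -[-> _]; rewrite ?E2.
Qed.

(** The vertex found is the one before [dst g], so its [nxt] is the last edge of the link. *)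
Lemma last_interior a g : lab a = g.+2 -> exists2 a, lab a = g.+2 &
  forall b, lab b = g.+2 -> pos b <= pos a.
Proof.
move=> la; have S := model_sub M.
have vG w : lab w = g.+2 -> w \in vset G.
  by move=> lw; apply: (sub_vset S); rewrite lw.
have exP : exists k, has (fun w => (lab w == g.+2) && (pos w == k)) (vset G).
  by exists (pos a); apply/hasP; exists a; rewrite ?vG // la !eqxx.
(* Any upper bound for the positions will do. *)
have ubP k : has (fun w => (lab w == g.+2) && (pos w == k)) (vset G) ->
    k <= \sum_(w <- vset G) pos w.
  case/hasP => w wG /andP[_ /eqP <-].
  by rewrite (big_rem w) //= leq_addr.
case: (ex_maxnP exP ubP) => k /hasP[w wG /andP[/eqP lw /eqP <-]] mx.
exists w => // b lb; apply: mx; apply/hasP; exists b; rewrite ?vG //.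
by rewrite lb !eqxx.
Qed.

(* The two end edges of the link of [a] do not separate its interior, together with
   what hangs from it, from the root. *)
Lemma good_edge_interior a : 1 < lab a -> lab root = 1 ->
  exists e u v, joins G e u v /\ good_edge lab es pe top rr e u v.
Proof.
have S := model_sub M.
case E: (lab a) => [//|[//|g]] _ lr.
have {a E}[a la amax] := last_interior E.
have [gH pa0 [h0 j0 _] _] := sub_interior S la.
have [[h1 j1 _] _] := sub_link S gH; rewrite /= in j1.
have aG : a \in vset G by apply: (sub_vset S); rewrite la.
have rG := tree_root T.
pose X := [fset w in vset G | lab (rr w) == g.+2].
have aX : a \in X.
  have la0 : lab a != 0 by rewrite la.
  by rewrite !inE /= aG /=; have [_ ->] := hanging_labelled aG la0; rewrite la.
have rX : root \notin X.
  by rewrite !inE /= rG /=; have [_ ->] := hanging_labelled rG lab_root; rewrite lr.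
have sD : [fset g; nxt a] `<=` eset G.
  by apply/fsubsetP => e; rewrite !inE => /orP[]/eqP ->;
    [exact: joins_eset j1 | exact: joins_eset j0].
have cD : #|` [fset g; nxt a]| <= 2 by rewrite cardfs2; case: eqP.
have [e [u [v [j eD uX vX]]]] := crossing_edge G3 sD cD aG aX rG rX.
have [uG vG] := joins_vset j.
move: uX vX; rewrite !inE /= uG vG /= => /eqP lu lv.
have Err : rr u <> rr v by move=> Er; rewrite -Er lu eqxx in lv.
exists e, u, v; split=> //; rewrite /good_edge lu [g.+2 == _]eq_sym lv /=.
(* A vertex outside S and its parent have the same [rr], so its tree edge does not leave [X]. *)
have up w z : joins G e w z -> rr w <> rr z -> ~~ ((lab w == 0) && (pe w == e)).
  move=> jw rwz; have [wG zG] := joins_vset jw.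
  apply/negP => /andP[/eqP lw /eqP Ee].
  have [jp _] := tree_edge T wG (unlabelled_root lw).
  have [_ _ _ rw] := hanging_unlabelled wG lw.
  by rewrite Ee in jp; apply: rwz; rewrite rw (joins_inj jw jp).
rewrite (up _ _ j) // (up _ _ (joinsC j)) /=; last by move=> Er; apply: Err.
rewrite andbT; apply/andP; split; last by apply/eqP => /top_rr -/(_ uG vG).
(* An edge of S has both ends in S. With one end interior to the link [g] and the other not, it
   would be the first edge [g] or the last edge [nxt a], and both are deleted. *)
apply/negPn/negP => ee.
have {lu}lu : lab u = g.+2.
  by have [_ ru] := hanging_labelled uG (used_edge_ends ee j); rewrite ru in lu.
have {lv}lv : lab v != g.+2.
  by have [_ rv] := hanging_labelled vG (used_edge_ends ee (joinsC j)); rewrite rv in lv.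
move: eD; rewrite !inE => /norP[/eqP eg /eqP ea].
case Ee: (es e) ee => [//|[|b]] _.
  have [g' gH' /= E1] := sub_es1 S Ee; have [[h j' nh] _] := sub_link S gH'.
  have [ls ld] := link_ends_branch gH'; subst g'.
  case: (joins_uniq j j') => -[E2 E3]; first by rewrite E2 ls in lu.
  case: nh => [[lh _ _]|[hd _]]; last by rewrite E2 hd ld in lu.
  by rewrite -E2 lu in lh; case: lh => E4; case: eg.
have [lb E1] := sub_es2 S Ee; case E2: (lab b) lb => [//|[//|g']] _.
have [gH' pb [h j' nh] _] := sub_interior S E2; rewrite E1 in j'.
have [ls ld] := link_ends_branch gH'.
case: (joins_uniq j j') => -[E3 E4].
  move: E2; rewrite -E3 lu => -[E5].
  case: nh => [[lh _ _]|[hd mh]]; first by rewrite E4 lh E5 eqxx in lv.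
  apply: ea; rewrite -E1; congr nxt; rewrite -E5 in mh.
  by apply: (sub_pos S (g := g)) => //; [rewrite -E3|
    apply/eqP; rewrite eqn_leq mh // amax // -E3].
case: nh => [[lh _ _]|[hd _]]; last by rewrite E3 hd ld in lu.
by rewrite -E3 lu in lh; case: lh => E5; rewrite E4 E2 E5 eqxx in lv.
Qed.

Lemma good_edge_uncovered w : (forall a, lab a <= 1) ->
  w \in vset G -> lab w = 0 ->
  exists e u v, joins G e u v /\ good_edge lab es pe top rr e u v.
Proof.
move=> lab1 wG lw; have rG := tree_root T.
have [cG lc _ _] := hanging_unlabelled wG lw; set c := top w in cG lc.
have [jc _] := tree_edge T cG (unlabelled_root lc).
pose X := [fset z in vset G | top z == c].
have wX : w \in X by rewrite !inE /= wG /= eqxx.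
have rX : root \notin X.
  rewrite !inE /= rG /=; have [-> _] := hanging_labelled rG lab_root.
  by rewrite eq_sym unlabelled_root.
have sD : [fset pe c] `<=` eset G.
  by apply/fsubsetP => e; rewrite !inE => /eqP ->; exact: joins_eset jc.
have cD : #|` [fset pe c]| <= 2 by rewrite cardfs1.
have [e [u [v [j eD uX vX]]]] := crossing_edge G3 sD cD wG wX rG rX.
have [uG vG] := joins_vset j.
move: uX vX eD; rewrite !inE /= uG vG /= => /eqP tu tv /eqP ec.
have rr1 z : z \in vset G -> lab (rr z) == 1.
  by move=> zG; have [_ r0] := hanging_rr zG; rewrite eqn_leq lab1 lt0n.
have lu : lab u = 0.
  have [//|lu] := eqVneq (lab u) 0.
  by have [E _] := hanging_labelled uG lu; rewrite -E tu lc in lu.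
exists e, u, v; split=> //; rewrite /good_edge !rr1 // lu tu [c == _]eq_sym tv.
rewrite eqxx /= orbT ?andbT.
have {rX wX sD cD X} ne : es e == 0.
  by apply/negPn/negP => ee; have := used_edge_ends ee j; rewrite lu.
rewrite ne /=; apply/andP; split.
  (* If [e] were the tree edge of [u], then [v] would be the parent of [u]: either outside S with
     the same [top], or in S, and then [u] is [c] and [e] is the deleted edge. *)
  apply/eqP => Ee; have [jp _] := tree_edge T uG (unlabelled_root lu).
  rewrite Ee in jp; have := Hg uG; rewrite /hanging lu eqxx -(joins_inj j jp).
  case: ifP => [_ [E _]|_ [E _]]; first by rewrite -E tu eqxx in tv.
  by apply: ec; rewrite -Ee -tu E.
apply/negP => /andP[/eqP lv /eqP Ee].
have [jp _] := tree_edge T vG (unlabelled_root lv).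
rewrite Ee in jp; have := Hg vG; rewrite /hanging lv eqxx -(joins_inj (joinsC j) jp).
by rewrite lu eqxx => -[E _]; rewrite E tu eqxx in tv.
Qed.

End Good.
End Hanging.
End Tree.

Section Model.
Variables (G : graph) (pe : nat -> nat) (H : graph).
Variables lab pos nxt src dst es : nat -> nat.
Hypothesis M : model G pe H lab pos nxt src dst es.

(** The first half reuses the name of the divided edge, as [divide] allows; [nxt a] is a fresh name
    because it is not the first edge of any link. *)
Lemma divide_model a g lab' : lab a = g.+2 ->
  (forall w, lab' w = if w == a then 1 else
     if (lab w == g.+2) && (pos a < pos w) then (nxt a).+2 else lab w) ->
  exists H1, [/\ divide g (src g) (dst g) g (nxt a) a H H1,
    eset H1 = nxt a |` eset H &
    model G pe H1 lab' pos nxt (upd src (nxt a) a)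
      (upd (upd dst (nxt a) (dst g)) g a) (upd es (nxt a) 1)].
Proof.
move=> la E; have S := model_sub M; have [gH _ _ ea] := sub_interior S la.
have fH : nxt a \notin eset H.
  by apply/negP => fH; have [_] := sub_link S fH; rewrite /= ea.
have gf : g != nxt a by apply/eqP => E1; rewrite -E1 gH in fH.
have aH : a \notin vset H by rewrite (model_vset M) la.
have [] := @exists_divide g (src g) (dst g) g (nxt a) a H _ aH.
- exact: (model_joins M).
- by rewrite gf !inE eqxx (negbTE fH) andbF.
move=> H1 D; exists H1; have [_ _ _ EV EE] := D.
have EL : eset H1 = nxt a |` eset H.
  apply/fsetP => e; rewrite /eset EE !inE.
  rewrite (_ : (e \in domf (ends H)) = (e \in eset H)) //.
  have [//|_] := eqVneq e (nxt a).
  by have [->|_] := eqVneq e g; rewrite ?gH ?andbb.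
split=> //; split.
- move=> v; rewrite EV !inE (model_vset M) E; have [//|va] := eqVneq v a.
  by case: ifP => //= /andP[/eqP -> _].
- move=> e; rewrite EL !inE /joins EE !fnd_set fnd_rem1 /upd.
  have [->|ef] := eqVneq e (nxt a); first by rewrite [nxt a == g]eq_sym (negbTE gf).
  have [-> _|eg /= eH] := eqVneq e g; [by []|exact: (model_joins M eH)].
- by rewrite EL; apply: (split_link S) la E.
Qed.

(** H only depends on the label 1 and on the ends of links; all that concerns their interior is left
    to the last hypothesis. The ear must be complete, so that [fst'] is the identity again. *)
Lemma add_edge_model f x y lab' pos' nxt' src' dst' es' fst' :
  f \notin eset H -> lab x = 1 -> lab y = 1 ->
  (forall v, (lab' v == 1) = (lab v == 1)) ->
  (forall g, g \in eset H -> src' g = src g /\ dst' g = dst g) ->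
  src' f = x -> dst' f = y -> fst' =1 id ->
  subdivision G pe lab' pos' nxt' src' dst' es' (f |` eset H) fst' ->
  exists2 H', add_edge f x y H H' & model G pe H' lab' pos' nxt' src' dst' es'.
Proof.
move=> fH lx ly El Esd sx dy fid S.
have xH : x \in vset H by rewrite (model_vset M) lx.
have yH : y \in vset H by rewrite (model_vset M) ly.
have [H' A] := exists_add_edge xH yH fH; exists H' => //.
have [_ _ _ EV EE] := A.
have EL : eset H' = f |` eset H.
  by apply/fsetP => e; rewrite /eset EE !inE.
split.
- by move=> v; rewrite EV El (model_vset M).
- move=> e; rewrite EL !inE /joins EE !fnd_set.
  case: eqP => [-> _|_ /= eH]; first by rewrite sx dy.
  by have [-> ->] := Esd e eH; exact: (model_joins M eH).
- by rewrite EL; apply: (subdivision_ext S) => g; rewrite fid.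
Qed.

(** Without interior vertices a link is a single edge of [G], namely the one it is named after, so H
    and [G] agree edge by edge. Their equality as records then rests on the well-formedness proof
    being boolean. *)
Lemma model_complete : (forall v, v \in vset G -> lab v = 1) ->
  (forall e, e \in eset G -> es e != 0) -> H = G.
Proof.
move=> lab1 esn; have S := model_sub M.
have labG v : (lab v == 1) = (v \in vset G).
  apply/eqP/idP => [lv|/lab1 //]; apply: (sub_vset S); by rewrite lv.
have EV : vset H = vset G by apply/fsetP => v; rewrite (model_vset M) labG.
have nolab a g : lab a <> g.+2.
  move=> la; have aG : a \in vset G by apply: (sub_vset S); rewrite la.
  by rewrite lab1 in la.
have jG g : g \in eset H -> joins G g (src g) (dst g).
  move=> gH; have [[h j nh] _] := sub_link S gH.
  by case: nh => [[/nolab]|[<-]].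
have EE : ends H = ends G.
  apply/fmapP => e; have [eH|eH] := boolP (e \in eset H).
    have /eqP -> := model_joins M eH; by have /eqP -> := jG _ eH.
  have [eG|eG] := boolP (e \in eset G); last by rewrite !not_fnd.
  have := esn e eG; case Ee: (es e) => [//|[|a]] _.
    by have [g gH Eg] := sub_es1 S Ee; rewrite -Eg gH in eH.
  by have [] := sub_es2 S Ee; case E: (lab a) => [//|[//|g]]; case: (nolab a g).
case: (H) (G) EV EE => [V1 E1 w1] [V2 E2 w2] /= EV EE; subst V2 E2.
by congr Graph; apply: eq_irrelevance.
Qed.

End Model.

(** * Programs with bounded loops *)

(* Unlike [cmd], this fragment always terminates: [PFor i big p] runs [p] with
   register [i] counting up to the value of register 0, or of register 1 if [big];
   they will contain the number of vertices and of entries. *)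
Inductive prog :=
| PSkip
| PSet (x : nat) (e : expr)
| PSto (a : nat) (i e : expr)
| POut (e : expr)
| PSeq (p q : prog)
| PIf (b : test) (p q : prog)
| PFor (i : nat) (big : bool) (p : prog).

Fixpoint run (p : prog) (s : state) : state :=
  match p with
  | PSkip => s
  | PSet x e => set_reg s x (eval s e)
  | PSto a i e => set_arr s a (eval s i) (eval s e)
  | POut e => emit s (eval s e)
  | PSeq p q => run q (run p s)
  | PIf b p q => if holds s b then run p s else run q s
  | PFor i big p =>
      iteri (reg s big) (fun k s => set_reg (run p s) i k.+1) (set_reg s i 0)
  end.

Fixpoint compile (p : prog) : cmd :=
  match p with
  | PSkip => Skip
  | PSet x e => Assign x e
  | PSto a i e => Store a i e
  | POut e => Output e
  | PSeq p q => Seq (compile p) (compile q)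
  | PIf b p q => If b (compile p) (compile q)
  | PFor i big p =>
      Seq (Assign i (Const 0))
        (While (TestLt (Reg i) (Reg big))
           (Seq (compile p) (Assign i (Succ (Reg i)))))
  end.

Fixpoint writes_reg (p : prog) : seq nat :=
  match p with
  | PSet x _ => [:: x]
  | PSeq p q | PIf _ p q => writes_reg p ++ writes_reg q
  | PFor i _ p => i :: writes_reg p
  | _ => [::]
  end.

Fixpoint writes_arr (p : prog) : seq nat :=
  match p with
  | PSto a _ _ => [:: a]
  | PSeq p q | PIf _ p q => writes_arr p ++ writes_arr q
  | PFor i _ p => writes_arr p
  | _ => [::]
  end.

Fixpoint silent (p : prog) : bool :=
  match p with
  | POut _ => false
  | PSeq p q | PIf _ p q => silent p && silent q
  | PFor _ _ p => silent p
  | _ => true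
  end.

(** Registers 0 and 1, which bound the loops, are never written, and a loop body does not write its
    own counter. Hence the compiled while loop makes exactly the passes prescribed by [run]. *)
Fixpoint well_formed (p : prog) : bool :=
  match p with
  | PSet x _ => 1 < x
  | PSeq p q | PIf _ p q => well_formed p && well_formed q
  | PFor i _ p => [&& 1 < i, i \notin writes_reg p & well_formed p]
  | _ => true
  end.

(** A pass costs two units beyond the body, for the test and the counter; the final 2 pays for the
    initial assignment and the failing test. *)
Fixpoint time_bound (p : prog) (n M : nat) : nat :=
  match p with
  | PSeq p q => time_bound p n M + time_bound q n M
  | PIf _ p q => (time_bound p n M + time_bound q n M).+1
  | PFor _ big p => (if big then M else n) * (time_bound p n M + 2) + 2
  | _ => 1
  end.

Lemma iteri_ind (T : Type) (P : nat -> T -> Prop) (f : nat -> T -> T) (x : T) n :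
  P 0 x -> (forall k y, k < n -> P k y -> P k.+1 (f k y)) -> P n (iteri n f x).
Proof.
move=> P0 PS; elim: n PS => //= n IH PS.
by apply: (PS) => //; apply: IH => k y kn; apply: PS; lia.
Qed.

Lemma run_reg p s x : x \notin writes_reg p -> reg (run p s) x = reg s x.
Proof.
elim: p s => [|y e|a i e|e|p IHp q IHq|b p IHp q IHq|i big p IH] s //=.
- by rewrite inE => /negbTE ->.
- by rewrite mem_cat => /norP[xp xq]; rewrite IHq ?IHp.
- by rewrite mem_cat => /norP[xp xq]; case: ifP => _; rewrite ?IHq ?IHp.
rewrite inE => /norP[/negbTE xi xp].
apply: (@iteri_ind _ (fun _ s' => reg s' x = reg s x)) => /=; first by rewrite xi.
by move=> k y _ E; rewrite xi IH.
Qed.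

Lemma run_arr p s a : a \notin writes_arr p -> arr (run p s) a = arr s a.
Proof.
elim: p s => [|y e|a' i e|e|p IHp q IHq|b p IHp q IHq|i big p IH] s //=.
- by rewrite inE => /negbTE ->.
- by rewrite mem_cat => /norP[xp xq]; rewrite IHq ?IHp.
- by rewrite mem_cat => /norP[xp xq]; case: ifP => _; rewrite ?IHq ?IHp.
move=> xp.
apply: (@iteri_ind _ (fun _ s' => arr s' a = arr s a)) => //=.
by move=> k y _ E; rewrite IH.
Qed.

Lemma run_out p s : silent p -> out (run p s) = out s.
Proof.
elim: p s => [|y e|a' i e|e|p IHp q IHq|b p IHp q IHq|i big p IH] s //=.
- by move=> /andP[xp xq]; rewrite IHq ?IHp.
- by move=> /andP[xp xq]; case: ifP => _; rewrite ?IHq ?IHp.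
move=> xp.
apply: (@iteri_ind _ (fun _ s' => out s' = out s)) => //=.
by move=> k y _ E; rewrite IH.
Qed.

Lemma well_formed_reg p x : well_formed p -> x <= 1 -> x \notin writes_reg p.
Proof.
move=> + x1; elim: p => //= [y e|p IHp q IHq|b p IHp q IHq|i big p IH].
- by rewrite inE; lia.
- by move=> /andP[/IHp xp /IHq xq]; rewrite mem_cat negb_or xp.
- by move=> /andP[/IHp xp /IHq xq]; rewrite mem_cat negb_or xp.
by move=> /and3P[i1 _ /IH xp]; rewrite inE negb_or xp andbT; lia.
Qed.

Lemma compile_exec p s : well_formed p ->
  exists2 t, exec (compile p) s t (run p s) &
    t <= time_bound p (reg s 0) (reg s 1).
Proof.
elim: p s => [|y e|a i e|e|p IHp q IHq|b p IHp q IHq|i big p IH] s /=.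
1-4: by move=> _; exists 1 => //; constructor.
- move=> /andP[wp wq]; have [t1 e1 b1] := IHp s wp.
  have [t2 e2 b2] := IHq (run p s) wq; exists (t1 + t2); first exact: ExecSeq e1 e2.
  by rewrite !run_reg ?(well_formed_reg wp) // in b2; lia.
- move=> /andP[wp wq]; have [t1 e1 b1] := IHp s wp.
  have [t2 e2 b2] := IHq s wq.
  case E: (holds s b).
    by exists t1.+1; [apply: ExecIf; rewrite E | lia].
  by exists t2.+1; [apply: ExecIf; rewrite E | lia].
move=> /and3P[i1 ip wp].
have b1 : (big : nat) <= 1 by case: big.
have -> : (if big then reg s 1 else reg s 0) = reg s big by case: (big).
set N := reg s big; set T := time_bound _ _ _.
set f := fun k s => set_reg (run p s) i k.+1.
have ni x : x <= 1 -> (x == i) = false by lia.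
have inv k : [/\ reg (iteri k f (set_reg s i 0)) i = k,
    reg (iteri k f (set_reg s i 0)) 0 = reg s 0 &
    reg (iteri k f (set_reg s i 0)) 1 = reg s 1].
  elim: k => [|k [E0 E1 E2]] /=; first by rewrite eqxx !ni.
  by rewrite eqxx !ni // !run_reg ?(well_formed_reg wp).
have bigE k : reg (iteri k f (set_reg s i 0)) big = N.
  have [_ r0 r1] := inv k.
  have [E|E] : (big : nat) = 0 \/ (big : nat) = 1 by case: (big); [right|left].
    by rewrite /N E r0.
  by rewrite /N E r1.
(* Induction on the number [d] of passes left, since [exec] unfolds a while loop at its first pass,
   whereas [iteri] adds passes at the end. *)
have loop d k : k + d = N -> exists2 t,
    exec (While (TestLt (Reg i) (Reg big)) (Seq (compile p) (Assign i (Succ (Reg i)))))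
      (iteri k f (set_reg s i 0)) t (iteri N f (set_reg s i 0)) &
    t <= d * (T + 2) + 1.
  elim: d k => [|d IHd] k E.
    rewrite addn0 in E; exists 1 => //; rewrite E; apply: ExecWhileFalse => /=.
    by rewrite bigE; have [-> _ _] := inv N; rewrite ltnn.
  have [t2 e2 b2] := IHd k.+1 (etrans (addSnnS k d) E).
  set sk := iteri k f (set_reg s i 0) in inv bigE *.
  have [t1 e1 bd1] := IH sk wp.
  have [Ei E0 E1] := inv k; rewrite -/sk in Ei E0 E1.
  rewrite E0 E1 -/T in bd1.
  exists ((t1 + 1) + t2).+1; last by lia.
  apply: ExecWhileTrue e2; first by rewrite /= Ei bigE; lia.
  apply: ExecSeq e1 _.
  suff -> : iteri k.+1 f (set_reg s i 0) =
    set_reg (run p sk) i (eval (run p sk) (Succ (Reg i))) by constructor.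
  by rewrite /= run_reg // Ei.
have [t e bt] := loop N 0 erefl.
exists (1 + t); last by lia.
by apply: ExecSeq e; constructor.
Qed.

(** * Reading the input *)

(** The loop rule supplies the frame: invariants need not mention the arrays and registers that the
    body does not write. *)
Lemma run_for (P : nat -> state -> Prop) i (big : bool) p s :
  P 0 (set_reg s i 0) ->
  (forall k st, k < reg s big -> reg st i = k ->
     (forall a, a \notin writes_arr p -> arr st a = arr s a) ->
     (forall x, x \notin i :: writes_reg p -> reg st x = reg s x) ->
     P k st -> P k.+1 (set_reg (run p st) i k.+1)) ->
  P (reg s big) (run (PFor i big p) s).
Proof.
move=> P0 PS /=; set f := fun k s => _.
suff [] : [/\ reg (iteri (reg s big) f (set_reg s i 0)) i = reg s big,
  forall a, a \notin writes_arr p ->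
    arr (iteri (reg s big) f (set_reg s i 0)) a = arr s a,
  forall x, x \notin i :: writes_reg p ->
    reg (iteri (reg s big) f (set_reg s i 0)) x = reg s x &
  P (reg s big) (iteri (reg s big) f (set_reg s i 0))] by [].
apply: (@iteri_ind _ (fun k st => [/\ reg st i = k,
  forall a, a \notin writes_arr p -> arr st a = arr s a,
  forall x, x \notin i :: writes_reg p -> reg st x = reg s x & P k st])).
  split=> //=; first by rewrite eqxx.
  by move=> x; rewrite inE => /norP[/negbTE ->].
move=> k st kN [Ei Ea Ex Pk]; split; last exact: PS.
- by rewrite /= eqxx.
- by move=> a ap; rewrite /= run_arr // Ea.
move=> x xp; rewrite /= -(Ex x xp); move: xp; rewrite inE => /norP[/negbTE -> xp].
by rewrite run_reg.
Qed.

Notation aVert := 0 (only parsing).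
Notation aOff := 1 (only parsing).
Notation aEdge := 2 (only parsing).
Notation aHead := 3 (only parsing).
(* [aTail], [aEdge] and [aHead] give for each entry of the lists the edge and its
   ends.  The tree is described by parents [aPar], the edges [aPe] to them, and the
   numbering [aIdx] from 1, inverse to [aOrd] up to this shift.  The other arrays
   are the fields of [subdivision] and [hanging]. *)
Notation aTail := 4 (only parsing).
Notation aIdx := 5 (only parsing).
Notation aOrd := 6 (only parsing).
Notation aPar := 7 (only parsing).
Notation aPe := 8 (only parsing).
Notation aLab := 9 (only parsing).
Notation aTop := 10 (only parsing).
Notation aEs := 11 (only parsing).
Notation aNxt := 12 (only parsing).
Notation aPos := 13 (only parsing).
Notation aSrc := 14 (only parsing).
Notation aDst := 15 (only parsing).
Notation aRr := 16 (only parsing).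

(** [rI] and [rJ] count loops, [rK] counts the vertices of the tree, and [rW] is the current vertex.
    [rF] is the result of the scan; [rU], [rV], [rE] are the good edge, [rX], [rY] the points where
    its tree paths meet S, and [rL] the name of the new link. While the ear is traced, [rC] is its
    first edge so far and [rQ] the next position. [rG], [rH], [rT] are the link being divided, its
    second half and its label. *)
Notation rI := 2 (only parsing).
Notation rJ := 3 (only parsing).
Notation rK := 4 (only parsing).
Notation rW := 5 (only parsing).
Notation rF := 6 (only parsing).
Notation rU := 7 (only parsing).
Notation rV := 8 (only parsing).
Notation rE := 9 (only parsing).
Notation rX := 10 (only parsing).
Notation rY := 11 (only parsing).
Notation rL := 12 (only parsing).
Notation rC := 13 (only parsing).
Notation rQ := 14 (only parsing).
Notation rG := 15 (only parsing).
Notation rH := 16 (only parsing).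
Notation rT := 17 (only parsing).

Infix ";;" := PSeq (at level 60, right associativity).
Notation "a .{ i }" := (Get a i) (at level 2, format "a .{ i }").
Notation is_zero e := (TestEq e (Const 0)).

(** All pairs of a vertex and an entry are tried, because loops have only two possible lengths; the
    time n * M is within the bound. *)
Definition tails_prog : prog :=
  PFor rI false (PFor rJ true
    (PIf (TestAnd (TestNot (TestLt (Reg rJ) aOff.{Reg rI}))
                  (TestLt (Reg rJ) aOff.{Succ (Reg rI)}))
      (PSto aTail (Reg rJ) aVert.{Reg rI})
      PSkip)).

Lemma tails_progP s :
  (forall i, i < reg s 0 -> arr s aOff i <= arr s aOff i.+1) ->
  forall i p, i < reg s 0 -> p < reg s 1 ->
    arr s aOff i <= p < arr s aOff i.+1 ->
    arr (run tails_prog s) aTail p = arr s aVert i.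
Proof.
move=> mono.
have offm i j : i <= j -> j <= reg s 0 -> arr s aOff i <= arr s aOff j.
  elim: j => [|j IH]; first by rewrite leqn0 => /eqP ->.
  rewrite leq_eqVlt ltnS => /predU1P[->//|ij] jN.
  exact: leq_trans (IH ij (ltnW jN)) (mono j jN).
move=> i p iN pM ip.
pose P k st := i < k -> arr st aTail p = arr s aVert i.
suff : P (reg s 0) (run tails_prog s) by apply.
apply: (@run_for P rI false) => // k st kN Ek EA EX Pk.
pose Q (j : nat) st' := if (arr s aOff k <= p < arr s aOff k.+1) && (p < j)
  then arr st' aTail p = arr s aVert k else arr st' aTail p = arr st aTail p.
have EX1 : reg st 1 = reg s 1 by rewrite EX.
have : Q (reg st 1) (run (PFor rJ true
    (PIf (TestAnd (TestNot (TestLt (Reg rJ) aOff.{Reg rI}))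
                  (TestLt (Reg rJ) aOff.{Succ (Reg rI)}))
      (PSto aTail (Reg rJ) aVert.{Reg rI})
      PSkip)) st).
  apply: (@run_for Q rJ true) => [|j st' jM Ej EA' EX' Qj].
    by rewrite /Q andbF.
  have Ei : reg st' rI = k by rewrite EX'.
  move: Qj; rewrite /Q /= Ei Ej -leqNgt (EA' 1 isT) (EA 1 isT).
  have [->|pj] := eqVneq p j.
    rewrite ltnn ltnSn andbF andbT => Qj.
    by case: (_ <= _ < _) Qj => //= _; rewrite eqxx (EA' 0 isT) (EA 0 isT).
  have -> : (p < j.+1) = (p < j) by rewrite ltnS leq_eqVlt (negbTE pj).
  by case: ifP => _ Qj; case: ifP => //= _; rewrite (negbTE pj).
rewrite /P /Q EX1 pM andbT /= => Qk; rewrite ltnS leq_eqVlt => /predU1P[ik|ik].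
  by move: Qk; rewrite -ik ip.
move: Qk; case: ifP => [kp _|_ -> //]; last exact: Pk.
by have := offm _ _ ik (ltnW kN); lia.
Qed.

(** All that is needed of the adjacency list from here on. Edges occur in both orientations, which
    matters because [good_edge] is not symmetric in [u] and [v]. *)
Record entry_list (G : graph) (tail edge head : nat -> nat) (M : nat) : Prop :=
  EntryList {
  entry_joins : forall p, p < M -> joins G (edge p) (tail p) (head p);
  entry_pos : forall e u v, joins G e u v ->
    exists2 p, p < M & [/\ edge p = e, tail p = u & head p = v] }.

Section Input.
Variables (G : graph) (L : adjacency_list).
Hypothesis LG : adjacency_list_of G L.

Lemma input_size : #|` vset G| = size L.
Proof.
have [u E _] := LG; rewrite -(size_map fst) -/(unzip1 L).
by apply/perm_size/uniq_perm.
Qed.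

Let lists := unzip2 L.
Let off i := arr (input_state L) aOff i.

Lemma input_offset i : i <= size L -> off i = sumn (take i (shape lists)).
Proof. by move=> iL; rewrite /off /= nth_mkseq. Qed.

Lemma size_lists : size (shape lists) = size L.
Proof. by rewrite !size_map. Qed.

Lemma input_offset_size : off (size L) = sumn (shape lists).
Proof. by rewrite input_offset // -size_lists take_size. Qed.

Lemma input_offsetS i : i < size L ->
  off i.+1 = off i + size (nth [::] lists i).
Proof.
move=> iL; rewrite !input_offset ?(ltnW iL) // (take_nth 0) ?size_lists //.
by rewrite sumn_rcons (nth_map [::]) // size_map.
Qed.

Lemma input_entries s :
  arr s aEdge = arr (input_state L) aEdge ->
  arr s aHead = arr (input_state L) aHead ->
  (forall i p, i < size L -> p < off (size L) -> off i <= p < off i.+1 ->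
     arr s aTail p = nth 0 (unzip1 L) i) ->
  entry_list G (arr s aTail) (arr s aEdge) (arr s aHead) (off (size L)).
Proof.
move=> -> -> Et; have [u EV jL] := LG.
have sL : size lists = size L by rewrite size_map.
have nthL r : r < size L -> (nth 0 (unzip1 L) r, nth [::] lists r) \in L.
  move=> rL; have -> : (nth 0 (unzip1 L) r, nth [::] lists r) = nth (0, [::]) L r.
    by rewrite !(nth_map (0, [::])) //; case: nth.
  exact: mem_nth.
have Mlt r c : r < size L -> c < size (nth [::] lists r) ->
    off r + c < off (size L) /\ off r <= off r + c < off r.+1.
  move=> rL cl; rewrite input_offsetS // leq_addr ltn_add2l cl.
  rewrite input_offset_size (input_offset (ltnW rL)); split=> //.
  by apply: flatten_indexP; rewrite (nth_map [::]) // sL.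
have nthE r c : r < size L -> c < size (nth [::] lists r) ->
    nth (0, 0) (flatten lists) (off r + c) = nth (0, 0) (nth [::] lists r) c.
  move=> rL cl; rewrite (input_offset (ltnW rL)) -/(flatten_index (shape lists) r c).
  have cl' : c < nth 0 (shape lists) r by rewrite (nth_map [::]) // sL.
  by rewrite nth_flatten flatten_indexKl // flatten_indexKr.
have Mf : off (size L) = size (flatten lists).
  by rewrite input_offset_size size_flatten.
split.
- move=> p pM; rewrite /= !(nth_map (0, 0)) -?Mf //.
  pose r := reshape_index (shape lists) p.
  pose c := reshape_offset (shape lists) p.
  rewrite input_offset_size in pM.
  have rL : r < size L by rewrite -size_lists; apply: reshape_indexP.
  have cl : c < size (nth [::] lists r).
    by have := reshape_offsetP pM; rewrite (nth_map [::]) // sL.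
  have Ep : off r + c = p.
    by rewrite (input_offset (ltnW rL)); apply: reshape_indexK.
  have [m1 m2] := Mlt r c rL cl; rewrite Ep in m1 m2.
  rewrite (Et r) // -Ep nthE //.
  have [_ /(_ _ _)<-] := jL _ _ (nthL r rL).
  by rewrite -surjective_pairing mem_nth.
move=> e v w j; have [vG wG] := joins_vset j.
have : v \in unzip1 L by rewrite EV.
move=> vL; pose r := index v (unzip1 L).
have rL : r < size L by rewrite -(size_map fst) index_mem.
have Ev : nth 0 (unzip1 L) r = v by rewrite nth_index.
have [_ /(_ e w)] := jL _ _ (nthL r rL); rewrite Ev j => ewl.
pose c := index (e, w) (nth [::] lists r).
have cl : c < size (nth [::] lists r) by rewrite index_mem.
have [m1 m2] := Mlt r c rL cl.
exists (off r + c) => //; rewrite (Et r) // Ev /= !(nth_map (0, 0)) -?Mf // nthE //.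
by rewrite nth_index.
Qed.

(** Double counting: an edge and one of its ends determine the other end, so a vertex lists an edge
    at most once, and an edge has at most two ends. *)
Lemma input_length : off (size L) <= 2 * #|` eset G|.
Proof.
have [u EV jL] := LG; rewrite input_offset_size.
pose inc e v := if (ends G).[? e] is Some s then v \in s else false.
have jinc e v w : joins G e v w -> inc e v.
  by rewrite /inc => /eqP ->; rewrite !inE eqxx.
have -> : sumn (shape lists) = \sum_(x <- L) size x.2.
  by rewrite sumnE /shape -map_comp big_map.
have szl x : x \in L -> size x.2 <= \sum_(e <- eset G) inc e x.1.
  case: x => v l xL /=; have [ul El] := jL _ _ xL.
  have ul1 : uniq (unzip1 l).
    rewrite map_inj_in_uniq // => -[e w] [e' w'] /=; rewrite !El => j j' E.
    by rewrite -E in j' *; rewrite (joins_inj j j').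
  rewrite -(size_map fst).
  have sub : {subset unzip1 l <= [seq e <- eset G | inc e v]}.
    move=> e /mapP[[e' w] /=]; rewrite El => j ->.
    by rewrite mem_filter (jinc _ _ _ j) (joins_eset j).
  apply: leq_trans (uniq_leq_size ul1 sub) _.
  by rewrite size_filter -sum1_count big_mkcond /=; apply: leq_sum => e _; case: (inc _ _).
apply: leq_trans (_ : \sum_(x <- L) \sum_(e <- eset G) inc e x.1 <= _).
  by rewrite !big_seq; apply: leq_sum => x; apply: szl.
rewrite exchange_big /=.
apply: leq_trans (_ : \sum_(e <- eset G) 2 <= _); last first.
  by rewrite big_const_seq count_predT iter_addn_0.
rewrite !big_seq; apply: leq_sum => e eG.
have -> : \sum_(x <- L) inc e x.1 = size [seq v <- unzip1 L | inc e v].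
  rewrite size_filter -sum1_count [RHS]big_mkcond big_map /=.
  by apply: eq_bigr => x _; case: (inc _ _).
have /andP[_ /andP[_ c2]] := forallP (ends_wf G) [` eG].
apply: leq_trans c2; apply: uniq_leq_size; first exact: filter_uniq.
by move=> v; rewrite mem_filter /inc (in_fnd eG) => /andP[].
Qed.

End Input.

(** * Building the spanning tree *)

Definition grow_tree_prog : prog :=
  PIf (TestAnd (TestNot (is_zero aIdx.{aTail.{Reg rJ}}))
               (is_zero aIdx.{aHead.{Reg rJ}}))
    (PSto aOrd (Reg rK) aHead.{Reg rJ} ;;
     PSet rK (Succ (Reg rK)) ;;
     PSto aPar aHead.{Reg rJ} aTail.{Reg rJ} ;;
     PSto aPe aHead.{Reg rJ} aEdge.{Reg rJ} ;;
     PSto aIdx aHead.{Reg rJ} (Reg rK))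
    PSkip.

Definition tree_prog : prog :=
  PSto aIdx aVert.{Const 0} (Const 1) ;;
  PSto aOrd (Const 0) aVert.{Const 0} ;;
  PSet rK (Const 1) ;;
  PFor rI false (PFor rJ true grow_tree_prog).

Record partial_tree (G : graph) (root : nat) (par pe idx ord : nat -> nat)
    (K : nat) : Prop := PartialTree {
  pt_ord : forall j, j < K -> ord j \in vset G /\ idx (ord j) = j.+1;
  pt_idx : forall w, idx w != 0 -> idx w <= K /\ ord (idx w).-1 = w;
  pt_root : idx root = 1;
  pt_edge : forall w, idx w != 0 -> w != root ->
    [/\ joins G (pe w) w (par w), 0 < idx (par w) & idx (par w) < idx w] }.

Section Grow.
Variables (G : graph) (root : nat) (par pe idx ord : nat -> nat) (K : nat).
Hypothesis T : partial_tree G root par pe idx ord K.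

Lemma grow_partial_tree e u v : joins G e u v -> idx u != 0 -> idx v = 0 ->
  partial_tree G root (upd par v u) (upd pe v e) (upd idx v K.+1) (upd ord K v)
    K.+1.
Proof.
move=> j iu iv; have vr : v <> root by move=> E; rewrite E (pt_root T) in iv.
have uv : u <> v by move=> E; rewrite E iv in iu.
split.
- move=> i; rewrite ltnS leq_eqVlt => /predU1P[->|iK].
    by rewrite /upd !eqxx; have [] := joins_vset j.
  have [oG oi] := pt_ord T iK; rewrite /upd; case: eqP => [|_]; first by lia.
  by case: eqP => // E; rewrite E iv in oi.
- move=> w; rewrite /upd; have [->|wv] := eqVneq w v; first by rewrite eqxx.
  move=> iw; have [wK ow] := pt_idx T iw.
  by case: eqP => [|_]; lia.
- by rewrite /upd; case: eqP => [E|_]; [case: vr|exact: pt_root T].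
- move=> w; rewrite /upd; have [->|wv] := eqVneq w v.
    move/eqP/negbTE: uv => -> _ _; have [iuK _] := pt_idx T iu.
    by split; [exact: joinsC|lia|lia].
  move=> iw wr; have [jw p0 pw] := pt_edge T iw wr; have [wK ow] := pt_idx T iw.
  by case: eqP => [E|//]; rewrite E iv in p0.
Qed.

Lemma partial_tree_size : K <= #|` vset G|.
Proof.
rewrite -(size_iota 0 K) -(size_map ord (iota 0 K)); apply: uniq_leq_size.
  rewrite map_inj_in_uniq ?iota_uniq // => i j; rewrite !mem_iota /= !add0n.
  by move=> /(pt_ord T)[_ Ei] /(pt_ord T)[_ Ej] E; move: Ei; rewrite E Ej; lia.
by move=> w /mapP[j]; rewrite mem_iota /= add0n => /(pt_ord T)[oG _] ->.
Qed.

Lemma partial_tree_full : (forall w, w \in vset G -> idx w != 0) ->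
  root \in vset G ->
  spanning_tree G root par pe idx /\ K = #|` vset G|.
Proof.
move=> full rG; split.
  split=> // w wG; first by have := full w wG; lia.
  by move=> wr; have [] := pt_edge T (full w wG) wr.
apply/eqP; rewrite eqn_leq partial_tree_size /=.
rewrite -(size_iota 0 K) -(size_map ord (iota 0 K)); apply: uniq_leq_size (fset_uniq _) _ => w wG.
have [wK ow] := pt_idx T (full w wG); apply/mapP; exists (idx w).-1 => //.
by rewrite mem_iota; have := full w wG; lia.
Qed.

End Grow.

Lemma connected_closed (G : graph) (A : pred nat) u :
  connected G -> u \in vset G -> A u ->
  (forall e v w, joins G e v w -> A v -> A w) -> forall v, v \in vset G -> A v.
Proof.
move=> [_ c] uG Au cl v vG; have [p pp <-] := c u v uG vG.
elim: p u Au pp {uG} => //= w p IH u Au /andP[/hasP[e _ j] pp].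
by apply: IH pp; apply: cl j Au.
Qed.

Lemma tree_progP (G : graph) s :
  connected G -> entry_list G (arr s aTail) (arr s aEdge) (arr s aHead) (reg s 1) ->
  (forall w, arr s aIdx w = 0) -> arr s aVert 0 \in vset G ->
  reg s 0 = #|` vset G| ->
  let s' := run tree_prog s in
  spanning_tree G (arr s aVert 0) (arr s' aPar) (arr s' aPe) (arr s' aIdx) /\
  (forall j, j < reg s 0 -> arr s' aOrd j \in vset G /\
     arr s' aIdx (arr s' aOrd j) = j.+1) /\
  (forall w, w \in vset G -> arr s' aIdx w <= reg s 0 /\
     arr s' aOrd (arr s' aIdx w).-1 = w).
Proof.
move=> Gc EL idx0; set root := arr s _ 0 => rG nG.
pose PT st := partial_tree G root (arr st aPar) (arr st aPe) (arr st aIdx)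
  (arr st aOrd) (reg st rK).
set s1 := run (PSto aIdx aVert.{Const 0} (Const 1) ;;
  PSto aOrd (Const 0) aVert.{Const 0} ;; PSet rK (Const 1)) s.
have T1 : PT s1.
  split.
  - by move=> [|//] _ /=; rewrite !eqxx.
  - by move=> w /=; rewrite -/root; have [->|_] := eqVneq w root; rewrite ?idx0 ?eqxx.
  - by rewrite /= eqxx.
  - by move=> w /=; rewrite -/root; have [->|_] := eqVneq w root; rewrite ?idx0 ?eqxx.
have E1 x : x != rK -> reg s1 x = reg s x by move=> /= /negbTE ->.
have A1 a : a \notin [:: aIdx; aOrd] -> arr s1 a = arr s a.
  by rewrite !inE => /norP[/negbTE /= a1 /negbTE /= a2]; rewrite /= a1 a2.
(* After n passes the first alternative would give more than n vertices. *)
pose Q k st := PT st /\ (k < reg st rK \/ forall w, w \in vset G -> arr st aIdx w != 0).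
have : Q (reg s1 0) (run (PFor rI false (PFor rJ true grow_tree_prog)) s1).
  apply: (@run_for Q rI false) => [|k st kN Ek EA EX [T kQ]].
    by split=> //; left.
  (* By the last clause, a pass that reaches no new vertex shows the set of reached vertices to be
     closed under adjacency, hence everything by connectedness. *)
  pose R j st' := [/\ PT st', reg st rK <= reg st' rK,
    forall w, arr st aIdx w != 0 -> arr st' aIdx w != 0 &
    reg st rK = reg st' rK -> forall p, p < j -> arr st' aIdx (arr s aTail p) != 0 ->
      arr st' aIdx (arr s aHead p) != 0].
  have M1 : reg st 1 = reg s 1 by rewrite EX // E1.
  have : R (reg st 1) (run (PFor rJ true grow_tree_prog) st).
    apply: (@run_for R rJ true) => [|j st' jM Ej EA' EX' [T' K' mono cl]].
      by split.
    have st4 : arr st' aTail = arr s aTail by rewrite EA' // EA // A1.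
    have st3 : arr st' aHead = arr s aHead by rewrite EA' // EA // A1.
    have st2 : arr st' aEdge = arr s aEdge by rewrite EA' // EA // A1.
    rewrite /= M1 in jM; have jo := entry_joins EL jM.
    rewrite /grow_tree_prog /= Ej st4 st3 st2.
    set c := ~~ _ && _; case Ec : c; rewrite /c in Ec.
      case/andP: Ec => iu /eqP iv.
      have T2 := grow_partial_tree T' jo iu iv.
      split=> //=; first by lia.
        by move=> w /mono; case: ifP.
      by move=> E; exfalso; lia.
    split=> // E p; rewrite ltnS leq_eqVlt => /predU1P[->|pj]; last exact: cl.
    move=> iu; rewrite iu /= in Ec.
    exact: negbT Ec.
  move=> [T' K' mono cl]; split=> //.
  case: kQ => [kK|full]; last by right=> w wG; apply: mono; apply: full.
  have [E|K2] := eqVneq (reg st rK) (reg (run (PFor rJ true grow_tree_prog) st) rK).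
    right; apply: connected_closed Gc rG _ _; first by rewrite /= (pt_root T').
    move=> e v w j iv; have [p pM [_ pv pw]] := entry_pos EL j.
    by rewrite -pw; apply: cl => //; rewrite ?M1 // pv.
  left; rewrite /= in K2 K' *; lia.
rewrite E1 // => -[T full].
have {}full : forall w, w \in vset G ->
    arr (run (PFor rI false (PFor rJ true grow_tree_prog)) s1) aIdx w != 0.
  case: full => // nK; have := partial_tree_size T; rewrite -nG; lia.
have [ST KE] := partial_tree_full T full rG; split; first exact: ST.
rewrite nG -KE; split; first by move=> j; apply: (pt_ord T).
by move=> w wG; apply: (pt_idx T); apply: full.
Qed.

(** * Finding good edges and dividing links *)

Record static (G : graph) (root : nat) (s : state) : Prop := Static {
  st_entries : entry_list G (arr s aTail) (arr s aEdge) (arr s aHead) (reg s 1);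
  st_tree : spanning_tree G root (arr s aPar) (arr s aPe) (arr s aIdx);
  st_ord : forall j, j < reg s 0 -> arr s aOrd j \in vset G /\
    arr s aIdx (arr s aOrd j) = j.+1;
  st_idx : forall w, w \in vset G -> arr s aIdx w <= reg s 0 /\
    arr s aOrd (arr s aIdx w).-1 = w;
  st_vert : forall w, w \in vset G -> exists2 i, i < reg s 0 & arr s aVert i = w }.

(** A condition on the program text, so that for each program it is settled by computation. *)
Definition keeps_static (p : prog) : bool :=
  all (fun a => a \notin writes_arr p)
    [:: aVert; aEdge; aHead; aTail; aIdx; aOrd; aPar; aPe]
  && (0 \notin writes_reg p) && (1 \notin writes_reg p).

Lemma static_run G root p s : keeps_static p -> static G root s ->
  static G root (run p s).
Proof.
rewrite /keeps_static /= => /andP[/andP[]].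
move=> /and5P[a0 a2 a3 a4 /and5P[a5 a6 a7 a8 _]] r0 r1 [S1 S2 S3 S4 S5].
by split; rewrite !run_arr // ?run_reg.
Qed.

Definition model_of (G : graph) (s : state) (H : graph) : Prop :=
  model G (arr s aPe) H (arr s aLab) (arr s aPos) (arr s aNxt) (arr s aSrc)
    (arr s aDst) (arr s aEs).

Definition sweep_prog : prog :=
  PFor rJ false (
    PSet rW aOrd.{Reg rJ} ;;
    PIf (is_zero aLab.{Reg rW})
      (PIf (is_zero aLab.{aPar.{Reg rW}})
         (PSto aTop (Reg rW) aTop.{aPar.{Reg rW}} ;;
          PSto aRr (Reg rW) aRr.{aPar.{Reg rW}})
         (PSto aTop (Reg rW) (Reg rW) ;; PSto aRr (Reg rW) aPar.{Reg rW}))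
      (PSto aTop (Reg rW) (Reg rW) ;; PSto aRr (Reg rW) (Reg rW))).

Lemma sweep_progP G root s : static G root s -> arr s aLab root != 0 ->
  let s' := run sweep_prog s in
  forall w, w \in vset G ->
    hanging (arr s aLab) (arr s aPar) (arr s' aTop) (arr s' aRr) w.
Proof.
move=> S lr s' w wG.
pose P k st := forall w, w \in vset G -> arr s aIdx w <= k ->
  hanging (arr s aLab) (arr s aPar) (arr st aTop) (arr st aRr) w.
suff : P (reg s 0) s' by apply=> //; case: (st_idx S wG).
apply: (@run_for P rJ false) => [|k st kN Ek EA EX Pk].
  by move=> z zG; have := tree_idx (st_tree S) zG; lia.
move=> z zG zk; rewrite /= Ek !(EA 6 isT) !(EA 9 isT) !(EA 7 isT).
have [oG oi] := st_ord S kN; set o := arr s _ k in oG oi *.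
have opar : o != root -> arr s aPar o != o.
  move=> or; have [_] := tree_edge (st_tree S) oG or.
  by apply: contraTneq => ->; rewrite ltnn.
have oroot : arr s aLab o = 0 -> o != root.
  by move=> lo; apply: contraNneq lr => <-; rewrite lo.
have [->|zo] := eqVneq z o.
  rewrite /hanging; case: eqP => [/oroot/opar/negbTE op|_]; last by rewrite /= !eqxx.
  by case: eqP => _ /=; rewrite !eqxx ?op.
have zk' : arr s aIdx z <= k.
  have [_ Ez] := st_idx S zG; move: zk; rewrite leq_eqVlt => /predU1P[E|//].
  by rewrite E /= in Ez; case/eqP: zo; rewrite -Ez.
have := Pk z zG zk'; rewrite /hanging.
(* The stores at [o] do not affect an earlier vertex [z]: its parent has an even smaller number, so
   it is not [o]. *)
have zp : arr s aLab z = 0 -> arr s aPar z != o.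
  move=> lz; have zr : z != root by apply: contraNneq lr => <-; rewrite lz.
  have [j ip] := tree_edge (st_tree S) zG zr.
  by apply/eqP => E; rewrite E oi in ip; lia.
have [/zp/negbTE zp'|_] := eqVneq (arr s aLab z) 0.
  by case: (arr s aLab o == 0); case: (arr s aLab (arr s aPar o) == 0);
    rewrite /= ?(negbTE zo) ?zp'.
by case: (arr s aLab o == 0); case: (arr s aLab (arr s aPar o) == 0);
  rewrite /= ?(negbTE zo).
Qed.

Definition test_or b c := TestNot (TestAnd (TestNot b) (TestNot c)).

Definition good_test : test :=
  TestAnd (is_zero aEs.{Reg rE})
  (TestAnd (TestNot (TestAnd (is_zero aLab.{Reg rU}) (TestEq aPe.{Reg rU} (Reg rE))))
  (TestAnd (TestNot (TestAnd (is_zero aLab.{Reg rV}) (TestEq aPe.{Reg rV} (Reg rE))))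
  (TestAnd (TestNot (TestEq aTop.{Reg rU} aTop.{Reg rV}))
  (test_or
    (TestAnd (TestLt (Const 1) aLab.{aRr.{Reg rU}})
       (TestNot (TestEq aLab.{aRr.{Reg rU}} aLab.{aRr.{Reg rV}})))
    (TestAnd (TestEq aLab.{aRr.{Reg rU}} (Const 1))
       (TestAnd (TestEq aLab.{aRr.{Reg rV}} (Const 1)) (is_zero aLab.{Reg rU}))))))).

Definition scan_entry_prog : prog :=
  PSet rU aTail.{Reg rJ} ;; PSet rV aHead.{Reg rJ} ;; PSet rE aEdge.{Reg rJ} ;;
  PIf good_test (PSet rF (Succ (Reg rJ))) PSkip.

(** [rF] holds one more than the position of the last good entry seen, so that 0 means that there is
    none. *)
Definition scan_prog : prog :=
  PSet rF (Const 0) ;; PFor rJ true scan_entry_prog.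

Definition good_entry (s : state) (p : nat) : bool :=
  good_edge (arr s aLab) (arr s aEs) (arr s aPe) (arr s aTop) (arr s aRr)
    (arr s aEdge p) (arr s aTail p) (arr s aHead p).

Lemma holds_good_test s : holds s good_test =
  good_edge (arr s aLab) (arr s aEs) (arr s aPe) (arr s aTop) (arr s aRr)
    (reg s rE) (reg s rU) (reg s rV).
Proof. by rewrite /good_edge -[X in [&& _, _, _, _ & X]]negbK negb_or. Qed.

Lemma scan_progP s : let f := reg (run scan_prog s) rF in
  if f == 0 then forall p, p < reg s 1 -> ~~ good_entry s p
  else f.-1 < reg s 1 /\ good_entry s f.-1.
Proof.
pose P k st := let f := reg st rF in
  if f == 0 then forall p, p < k -> ~~ good_entry s p
  else f.-1 < k /\ good_entry s f.-1.
set s1 := run (PSet rF (Const 0)) s.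
suff : P (reg s1 true) (run (PFor rJ true scan_entry_prog) s1) by [].
apply: run_for => // k st kN Ek EA EX.
have A a : a \notin [::] -> arr st a = arr s a by move=> /EA ->.
rewrite /P /scan_entry_prog /run -/run holds_good_test /= Ek !A // -/(good_entry s k).
case g: (good_entry s k); first by rewrite /= ltnSn g.
case: ifP => /= _ Pk; last by case: Pk => lk gk; split=> //; lia.
move=> p; rewrite ltnS leq_eqVlt => /predU1P[->|]; [by rewrite g | exact: Pk].
Qed.

Lemma run_seq p q s : run (p ;; q) s = run q (run p s).
Proof. by []. Qed.

Lemma run_if b p q s :
  run (PIf b p q) s = if holds s b then run p s else run q s.
Proof. by []. Qed.

Definition split_load_prog (r : nat) : prog :=
  PSet rT aLab.{Reg r} ;; PSet rG (Pred (Pred (Reg rT))) ;; PSet rH aNxt.{Reg r}.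

(** The output consists of the arguments [f x y f1 f2 a] of the division, with [f1 = f]. It comes
    before the stores, which overwrite the old end of the link. *)
Definition split_store_prog (r : nat) : prog :=
  POut (Reg rG) ;; POut aSrc.{Reg rG} ;; POut aDst.{Reg rG} ;;
  POut (Reg rG) ;; POut (Reg rH) ;; POut (Reg r) ;;
  PSto aSrc (Reg rH) (Reg r) ;; PSto aDst (Reg rH) aDst.{Reg rG} ;;
  PSto aDst (Reg rG) (Reg r) ;; PSto aEs (Reg rH) (Const 1) ;;
  PSto aLab (Reg r) (Const 1).

Definition relabel_prog (r : nat) : prog :=
  PFor rJ false
    (PIf (TestAnd (TestEq aLab.{aVert.{Reg rJ}} (Reg rT))
                  (TestLt aPos.{Reg r} aPos.{aVert.{Reg rJ}}))
       (PSto aLab aVert.{Reg rJ} (Succ (Succ (Reg rH)))) PSkip).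

Definition split_prog (r : nat) : prog :=
  split_load_prog r ;; split_store_prog r ;; relabel_prog r.

Lemma relabel_progP s r a t h :
  r \notin [:: rJ; rT; rH] -> reg s r = a -> reg s rT = t -> reg s rH = h ->
  let s' := run (relabel_prog r) s in
  forall w, arr s' aLab w =
    if has (fun i => arr s aVert i == w) (iota 0 (reg s 0)) &&
       ((arr s aLab w == t) && (arr s aPos a < arr s aPos w))
    then h.+2 else arr s aLab w.
Proof.
move=> rN ra rt rh.
pose P k st := forall w, arr st aLab w =
  if has (fun i => arr s aVert i == w) (iota 0 k) &&
     ((arr s aLab w == t) && (arr s aPos a < arr s aPos w))
  then h.+2 else arr s aLab w.
apply: (@run_for P rJ false) => // k st kN Ek EA EX Pk w.
have rJr : r != rJ by move: rN; rewrite !inE => /norP[].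
have {EX}[Er Et Eh] : [/\ reg st r = a, reg st rT = t & reg st rH = h].
  by rewrite !EX // inE.
have -> : iota 0 k.+1 = rcons (iota 0 k) k by rewrite -addn1 iotaD cats1.
rewrite has_rcons orbC /= Ek Er Et Eh (EA 0 isT) (EA 13 isT).
move: (Pk w); rewrite (Pk (arr s aVert k)).
have [<-|nw] := eqVneq (arr s aVert k) w => Pw; last first.
  by rewrite orbF -Pw; case: ifP => _ //=; rewrite eq_sym (negbTE nw).
rewrite orbT andTb; move: Pw; set w0 := arr s aVert k.
case Ec: ((arr s aLab w0 == t) && _); last first.
  by rewrite !andbF Ec => ->.
rewrite andbT; case: (has _ _) => Pw; last by rewrite Ec /= eqxx.
by case: ifP => _ //=; rewrite eqxx.
Qed.

Lemma split_progP G root s H r a g :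
  static G root s -> model_of G s H ->
  r \notin [:: rJ; rT; rH; rG] -> reg s r = a -> arr s aLab a = g.+2 ->
  let s' := run (split_prog r) s in
  [/\ exists H1, [/\ divide g (arr s aSrc g) (arr s aDst g) g (arr s aNxt a) a H H1,
        eset H1 = arr s aNxt a |` eset H & model_of G s' H1],
      out s' = out s ++ [:: g; arr s aSrc g; arr s aDst g; g; arr s aNxt a; a],
      (forall w, arr s' aLab w = if w == a then 1 else
        if (arr s aLab w == g.+2) && (arr s aPos a < arr s aPos w)
        then (arr s aNxt a).+2 else arr s aLab w) &
      arr s' aEs = upd (arr s aEs) (arr s aNxt a) 1].
Proof.
move=> S M rN ra la; set p := relabel_prog r.
move: (rN); rewrite !inE => /norP[rj /norP[rt /norP[rh rg]]].
set s0 := run (split_load_prog r) s.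
have E0 : [/\ reg s0 r = a, reg s0 rT = g.+2, reg s0 rG = g & reg s0 rH = arr s aNxt a].
  by rewrite /s0 /= (negbTE rt) (negbTE rg) (negbTE rh) ra la.
have F0 : [/\ arr s0 = arr s, out s0 = out s & reg s0 0 = reg s 0] by [].
rewrite /split_prog run_seq run_seq -/s0 -/p.
(* Forgetting how the state was reached keeps simplification from unfolding the programs again; the
   same is done between later stages. *)
move: s0 E0 F0 => s0 [ra0 rt0 rg0 rh0] [A0 O0 n0].
set s1 := run (split_store_prog r) s0.
have [r1 t1 h1] : [/\ reg s1 r = a, reg s1 rT = g.+2 & reg s1 rH = arr s aNxt a] by [].
have A1 : [/\ arr s1 aSrc = upd (arr s aSrc) (arr s aNxt a) a,
  arr s1 aDst = upd (upd (arr s aDst) (arr s aNxt a) (arr s aDst g)) g a,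
  arr s1 aEs = upd (arr s aEs) (arr s aNxt a) 1,
  arr s1 aLab = upd (arr s aLab) a 1 &
  out s1 = out s ++ [:: g; arr s aSrc g; arr s aDst g; g; arr s aNxt a; a]].
  by rewrite /s1 /= ra0 rg0 rh0 A0 O0 -!cats1 -!catA.
have E1 b : b \notin [:: aSrc; aDst; aEs; aLab] -> arr s1 b = arr s b.
  by rewrite -A0 => bN; apply: run_arr; move: bN; rewrite /= !inE; lia.
have R0 : reg s1 0 = reg s 0 by [].
move: s1 r1 t1 h1 A1 E1 R0 => s1 r1 t1 h1 A1 E1 R0.
have [Asrc Adst Aes Alab Aout] := A1.
have L : forall w, arr (run p s1) aLab w = if w == a then 1 else
    if (arr s aLab w == g.+2) && (arr s aPos a < arr s aPos w)
    then (arr s aNxt a).+2 else arr s aLab w.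
  have rN' : r \notin [:: rJ; rT; rH] by rewrite !inE !negb_or rj rt rh.
  move=> w; rewrite (relabel_progP rN' r1 t1 h1) Alab R0 !E1 // /upd.
  have [->|wa] := eqVneq w a; first by rewrite ltnn !andbF.
  case lw: (arr s aLab w == g.+2); rewrite /= ?andbF //.
  have wG : w \in vset G.
    by apply: (sub_vset (model_sub M)); rewrite (eqP lw).
  have [i iN iw] := st_vert S wG.
  suff -> : has (fun i => arr s aVert i == w) (iota 0 (reg s 0)) by [].
  by apply/hasP; exists i; rewrite ?mem_iota ?iw /=.
split=> //; last 2 first.
- by rewrite run_out.
- by rewrite run_arr.
have [H1 [D EL M1]] := divide_model M la L.
have K b : b != aLab -> arr (run p s1) b = arr s1 b.
  by move=> bN; apply: run_arr; rewrite /= !inE.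
exists H1; split=> //; rewrite /model_of !(K 8, K 11, K 12, K 13, K 14, K 15) //.
by rewrite Asrc Adst Aes !E1.
Qed.

(** * Adding an ear *)

(** The walk from [u] to S runs against the direction of the link, so each vertex must be placed
    before the preceding ones; the tree numbers, which fall towards the root, serve as positions.
    Once the end lies in S, a pass changes no array. *)
Definition up_step_prog : prog :=
  PSet rW aSrc.{Reg rL} ;;
  PIf (is_zero aLab.{Reg rW})
    (PSto aNxt (Reg rW) (Reg rC) ;; PSto aEs (Reg rC) (Succ (Succ (Reg rW))) ;;
     PSet rC aPe.{Reg rW} ;; PSto aEs (Reg rC) (Const 1) ;;
     PSto aPos (Reg rW) aIdx.{Reg rW} ;;
     PSto aLab (Reg rW) (Succ (Succ (Reg rL))) ;;
     PSto aSrc (Reg rL) aPar.{Reg rW})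
    PSkip.

Definition down_step_prog : prog :=
  PSet rW aDst.{Reg rL} ;;
  PIf (is_zero aLab.{Reg rW})
    (PSto aNxt (Reg rW) aPe.{Reg rW} ;;
     PSto aEs aPe.{Reg rW} (Succ (Succ (Reg rW))) ;;
     PSto aPos (Reg rW) (Reg rQ) ;; PSet rQ (Succ (Reg rQ)) ;;
     PSto aLab (Reg rW) (Succ (Succ (Reg rL))) ;;
     PSto aDst (Reg rL) aPar.{Reg rW})
    PSkip.

Definition start_prog : prog :=
  PSto aSrc (Reg rL) (Reg rU) ;; PSto aDst (Reg rL) (Reg rV) ;;
  PSto aEs (Reg rE) (Const 1) ;; PSet rC (Reg rE).

(** Positions on the side of [v] count up from n + 1, just above all the tree numbers used on the
    side of [u]. *)
Definition ear_prog : prog :=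
  start_prog ;; PFor rJ false up_step_prog ;;
  PSet rQ (Succ (Reg 0)) ;; PFor rJ false down_step_prog.

Definition sub_of (G : graph) (st : state) (Lk : {fset nat}) (fst : nat -> nat) :=
  subdivision G (arr st aPe) (arr st aLab) (arr st aPos) (arr st aNxt)
    (arr st aSrc) (arr st aDst) (arr st aEs) Lk fst.

Section Ear.
Variables (G : graph) (root : nat) (s : state) (Lk : {fset nat}).
Variables (lab top rr : nat -> nat) (l : nat).
Hypothesis S : static G root s.
Hypothesis lab_root : lab root != 0.
Hypothesis Hg : forall w, w \in vset G -> hanging lab (arr s aPar) top rr w.
Hypothesis lL : reg s rL = l.
Hypothesis lLk : l \in Lk.

Let T := st_tree S.

Lemma unlabelled_tree c : c \in vset G -> lab c = 0 ->
  [/\ joins G (arr s aPe c) c (arr s aPar c), arr s aPar c \in vset G,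
      arr s aIdx (arr s aPar c) < arr s aIdx c,
      lab (arr s aPar c) = 0 -> top (arr s aPar c) = top c &
      lab (arr s aPar c) != 0 -> top c = c /\ rr c = arr s aPar c].
Proof.
move=> cG lc; have [j ip] := tree_edge T cG (unlabelled_root lab_root lc).
split=> //; first by have [] := joins_vset j.
  by move=> lp; have := Hg cG; rewrite /hanging lc lp => -[].
by move=> lp; have := Hg cG; rewrite /hanging lc (negbTE lp).
Qed.

(** [lab], [top] and [rr] stay those from before the ear, while the labels in the state change. If
    [u] is outside S, the last edge walked is [pe (top u)], which is the name [l] fixed in advance;
    so [fst] ends as the identity. *)
Lemma up_progP u : u \in vset G -> arr s aLab = lab -> arr s aSrc l = u ->
  (lab u != 0 -> reg s rC = l) -> (lab u = 0 -> l = arr s aPe (top u)) ->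
  (forall w, lab w <> l.+2) ->
  sub_of G s Lk (upd id l (reg s rC)) ->
  let s' := run (PFor rJ false up_step_prog) s in
  [/\ arr s' aSrc l = rr u /\ (forall g, g != l -> arr s' aSrc g = arr s aSrc g),
      sub_of G s' Lk id,
      forall w, lab w != 0 -> arr s' aLab w = lab w,
      forall w, lab w = 0 -> arr s' aLab w != 0 ->
        [/\ arr s' aLab w = l.+2, top w = top u & arr s' aPos w = arr s aIdx w] &
      lab u = 0 -> arr s' aLab u != 0].
Proof.
move=> uG labE su Clab lpe nol S0.
(* [c] is the current source end. Its tree number drops in each pass until S is reached, so n passes
   are enough; the vertices already absorbed have larger numbers, so [c] is not one of them. *)
pose P k st := let c := arr st aSrc l in
  [/\ sub_of G st Lk (upd id l (reg st rC)),
      forall g, g != l -> arr st aSrc g = arr s aSrc g,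
      forall w, lab w != 0 -> arr st aLab w = lab w,
      forall w, lab w = 0 -> arr st aLab w != 0 ->
        [/\ arr st aLab w = l.+2, top w = top u, arr st aPos w = arr s aIdx w &
            lab c = 0 -> arr s aIdx c < arr s aIdx w] &
      [/\ c \in vset G,
        lab c = 0 -> [/\ lab u = 0, top c = top u & arr s aIdx c + k <= arr s aIdx u],
        lab c != 0 -> c = rr u /\ reg st rC = l &
        lab u = 0 -> c = u \/ arr st aLab u != 0]].
have : P (reg s 0) (run (PFor rJ false up_step_prog) s).
  apply: (@run_for P rJ false) => [|k st kN Ek EA EX].
    rewrite /P /= su labE; split=> //; first by move=> w ->.
    split=> //; [by rewrite addn0 | | by left].
    move=> lu; split; last exact: Clab.
    by have [_ ->] := hanging_labelled Hg uG lu.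
  rewrite /P; set c := arr st aSrc l => -[Sst Esrc Elab Enew [cG c0 c1 cu]].
  have El : reg st rL = l by rewrite EX.
  have [E7 [E5 E8]] : arr st aPar = arr s aPar /\ arr st aIdx = arr s aIdx /\
    arr st aPe = arr s aPe by rewrite !EA.
  have lst : arr st aLab c = 0 <-> lab c = 0.
    split=> lc.
      by have [//|/Elab] := eqVneq (lab c) 0; rewrite lc => <-.
    have [//|/(Enew c lc)[_ _ _ /(_ lc)]] := eqVneq (arr st aLab c) 0.
    by rewrite ltnn.
  rewrite /up_step_prog run_seq.
  have -> : run (PSet rW aSrc.{Reg rL}) st = set_reg st rW c by rewrite /= El.
  set st1 := set_reg st rW c.
  have W1 : reg st1 rW = c by [].
  rewrite run_if; have [lc|lc] := eqVneq (lab c) 0; last first.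
    have -> : holds st1 (is_zero aLab.{Reg rW}) = false.
      by rewrite /=; apply/negbTE; apply: contraNneq lc => /lst ->.
    split=> //=; split=> // /eqP; by rewrite (negbTE lc).
  have hz : holds st1 (is_zero aLab.{Reg rW}) by rewrite /=; apply/eqP/lst.
  rewrite hz.
  have [lu tc ic] := c0 lc.
  have [j pG ip t0 t1] := unlabelled_tree cG lc.
  have l0 := (lst.2 lc).
  have pinj w : w \in vset G -> arr st aLab w = 0 ->
      arr st aPe w = arr st aPe c -> w = c.
    have nr z : arr st aLab z = 0 -> z != root.
      by apply: contra_eq_neq => ->; rewrite Elab.
    rewrite E8 => wG lw; apply: (tree_edge_inj T) => //; exact: nr.
  have posc b : arr st aLab b = l.+2 -> arr s aIdx c < arr st aPos b.
    move=> lb; have [lb0|lb0] := eqVneq (lab b) 0.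
      by have [_ _ -> /(_ lc)] := Enew b lb0 ltac:(by rewrite lb).
    by case: (nol b); rewrite -Elab.
  have i0 : 0 < arr s aIdx c := tree_idx T cG.
  have j' : joins G (arr st aPe c) c (arr s aPar c) by rewrite E8.
  have := grow_src Sst lLk l0 cG j' i0 posc pinj.
  rewrite -/c => Snew.
  set st2 := run _ st1.
  have [r2 [a9 a13 a12 a14 a15] [a11 a8]] : [/\ reg st2 rC = arr s aPe c,
     [/\ arr st2 aLab = upd (arr st aLab) c l.+2,
         arr st2 aPos = upd (arr st aPos) c (arr s aIdx c),
         arr st2 aNxt = upd (arr st aNxt) c (reg st rC),
         arr st2 aSrc = upd (arr st aSrc) l (arr s aPar c) &
         arr st2 aDst = arr st aDst] &
         arr st2 aEs = upd (upd (arr st aEs) (reg st rC) c.+2) (arr s aPe c) 1 /\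
         arr st2 aPe = arr st aPe].
    by rewrite /st2 /= E8 E5 E7 El; split.
  have S2 : sub_of G st2 Lk (upd id l (reg st2 rC)).
    rewrite /sub_of a8 a9 a13 a12 a14 a15 a11 r2.
    apply: (subdivision_ext (fst := upd (upd id l (reg st rC)) l (arr st aPe c))).
      have fl : upd id l (reg st rC) l = reg st rC by rewrite /upd eqxx.
      by rewrite fl E8 in Snew; rewrite E8.
    by move=> g; rewrite /upd E8; case: eqP.
  move: st2 r2 a9 a13 a12 a14 a15 a11 a8 S2 => st2 r2 a9 a13 a12 a14 a15 a11 a8 S2.
  have c2 : arr st2 aSrc l = arr s aPar c by rewrite a14 /upd eqxx.
  split; rewrite /= ?c2.
  - exact: S2.
  - by move=> g gl; rewrite a14 /upd (negbTE gl) Esrc.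
  - move=> w lw; rewrite a9 /upd; case: eqP => [E|_]; last exact: Elab.
    by rewrite E lc in lw.
  - move=> w lw; rewrite a9 a13 /upd; have [->|wc] := eqVneq w c; first by [].
    by move=> /(Enew w lw)[-> -> -> /(_ lc)]; split=> // _; exact: ltn_trans ip _.
  split=> //.
  - by move=> lp; rewrite t0 //; split=> //; rewrite addnS; apply: leq_trans ic; rewrite -addSn leq_add2r.
  - move=> /t1[tcc rc]; rewrite r2 lpe // -tc tcc; split=> //.
    have [_ _ -> _] := hanging_unlabelled T lab_root Hg uG lu.
    by rewrite -tc tcc.
  - move=> _; right; rewrite a9 /upd; have [//|/eqP uc] := eqVneq u c.
    by case: (cu lu) => // E; case: uc.
rewrite /P; set s' := run _ _; set c := arr s' aSrc l.
move=> [S' Esrc Elab Enew [cG c0 c1 cu]].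
have lc : lab c != 0.
  apply/eqP => /c0[_ _ cn]; have [iu _] := st_idx S uG.
  have ci : 0 < arr s aIdx c := tree_idx T cG.
  have := leq_trans cn iu; lia.
have [cr Cl] := c1 lc.
split=> //.
- by apply: (subdivision_ext S') => g; rewrite /upd Cl; case: eqP.
- by move=> w lw /(Enew w lw)[].
by move=> lu; case: (cu lu) => // E; rewrite E lu in lc.
Qed.

(** Up to S the walk stays on vertices with the [top] of [v], while those just labelled from the
    other side have the [top] of [u]; so it cannot run into the other half of the ear. *)
Lemma down_progP u v : v \in vset G -> arr s aDst l = v -> top u <> top v ->
  (forall w, lab w != 0 -> arr s aLab w = lab w) ->
  (forall w, lab w = 0 -> arr s aLab w != 0 -> top w = top u) ->
  0 < reg s rQ -> (forall b, arr s aLab b = l.+2 -> arr s aPos b < reg s rQ) ->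
  sub_of G s Lk id ->
  let s' := run (PFor rJ false down_step_prog) s in
  [/\ arr s' aDst l = rr v /\ (forall g, g != l -> arr s' aDst g = arr s aDst g),
      sub_of G s' Lk id,
      forall w, arr s aLab w != 0 -> arr s' aLab w = arr s aLab w &
      forall w, arr s aLab w = 0 -> arr s' aLab w != 0 -> arr s' aLab w = l.+2].
Proof.
move=> vG dv tuv Lold Lnew q0 posq S0.
pose P k st := let c := arr st aDst l in
  [/\ sub_of G st Lk id,
      forall g, g != l -> arr st aDst g = arr s aDst g,
      forall w, arr s aLab w != 0 -> arr st aLab w = arr s aLab w,
      forall w, arr s aLab w = 0 -> arr st aLab w != 0 ->
        arr st aLab w = l.+2 /\ (lab c = 0 -> arr s aIdx c < arr s aIdx w) &
      [/\ c \in vset G,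
        lab c = 0 -> top c = top v /\ arr s aIdx c + k <= arr s aIdx v,
        lab c != 0 -> c = rr v,
        0 < reg st rQ &
        forall b, arr st aLab b = l.+2 -> arr st aPos b < reg st rQ]].
have : P (reg s 0) (run (PFor rJ false down_step_prog) s).
  apply: (@run_for P rJ false) => [|k st kN Ek EA EX].
    rewrite /P /= dv; split=> //; first by move=> w ->.
    split=> //; first by rewrite addn0.
    by move=> lv; have [_ ->] := hanging_labelled Hg vG lv.
  rewrite /P; set c := arr st aDst l => -[Sst Edst Elab Enew [cG c0 c1 qst pst]].
  have El : reg st rL = l by rewrite EX.
  have [E7 [E5 E8]] : arr st aPar = arr s aPar /\ arr st aIdx = arr s aIdx /\
    arr st aPe = arr s aPe by rewrite !EA.
  have lst : arr st aLab c = 0 <-> lab c = 0.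
    split=> lc.
      have [//|lc0] := eqVneq (lab c) 0.
      by have := Elab c; rewrite Lold // => /(_ lc0); rewrite lc => <-.
    have s0 : arr s aLab c = 0.
      have [//|lc0] := eqVneq (arr s aLab c) 0.
      by have [tc _] := c0 lc; case: tuv; rewrite -tc -(Lnew _ lc lc0).
    have [//|/(Enew c s0)[_ /(_ lc)]] := eqVneq (arr st aLab c) 0.
    by rewrite ltnn.
  rewrite /down_step_prog run_seq.
  have -> : run (PSet rW aDst.{Reg rL}) st = set_reg st rW c by rewrite /= El.
  set st1 := set_reg st rW c.
  rewrite run_if; have [lc|lc] := eqVneq (lab c) 0; last first.
    have -> : holds st1 (is_zero aLab.{Reg rW}) = false.
      by rewrite /=; apply/negbTE; apply: contraNneq lc => /lst ->.
    split=> //=; split=> // /eqP; by rewrite (negbTE lc).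
  have hz : holds st1 (is_zero aLab.{Reg rW}) by rewrite /=; apply/eqP/lst.
  rewrite hz.
  have [tc ic] := c0 lc.
  have [j pG ip t0 t1] := unlabelled_tree cG lc.
  have l0 := (lst.2 lc).
  have pinj w : w \in vset G -> arr st aLab w = 0 ->
      arr st aPe w = arr st aPe c -> w = c.
    have nr z : arr st aLab z = 0 -> z != root.
      by apply: contra_eq_neq => ->; rewrite Elab Lold.
    rewrite E8 => wG lw; apply: (tree_edge_inj T) => //; exact: nr.
  have j' : joins G (arr st aPe c) c (arr s aPar c) by rewrite E8.
  have := grow_dst Sst lLk l0 cG j' qst pst pinj.
  rewrite -/c => Snew.
  set st2 := run _ st1.
  have [r2 [a9 a13 a12 a14 a15] [a11 a8]] : [/\ reg st2 rQ = (reg st rQ).+1,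
     [/\ arr st2 aLab = upd (arr st aLab) c l.+2,
         arr st2 aPos = upd (arr st aPos) c (reg st rQ),
         arr st2 aNxt = upd (arr st aNxt) c (arr s aPe c),
         arr st2 aDst = upd (arr st aDst) l (arr s aPar c) &
         arr st2 aSrc = arr st aSrc] &
         arr st2 aEs = upd (arr st aEs) (arr s aPe c) c.+2 /\
         arr st2 aPe = arr st aPe].
    by rewrite /st2 /= E8 E7 El; split.
  have S2 : sub_of G st2 Lk id.
    by rewrite /sub_of a8 a9 a13 a12 a14 a15 a11; rewrite E8 in Snew *.
  move: st2 r2 a9 a13 a12 a14 a15 a11 a8 S2 => st2 r2 a9 a13 a12 a14 a15 a11 a8 S2.
  have c2 : arr st2 aDst l = arr s aPar c by rewrite a14 /upd eqxx.
  split; rewrite /= ?c2.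
  - exact: S2.
  - by move=> g gl; rewrite a14 /upd (negbTE gl) Edst.
  - move=> w lw; rewrite a9 /upd; case: eqP => [E|_]; last exact: Elab.
    by have := Elab w lw; rewrite E l0 => E1; rewrite E -E1 in lw.
  - move=> w lw; rewrite a9 /upd; have [->|wc] := eqVneq w c; first by [].
    by move=> /(Enew w lw)[-> /(_ lc)]; split=> // _; exact: ltn_trans ip _.
  rewrite r2; split=> //.
  - move=> lp; rewrite t0 //; split=> //.
    by rewrite addnS; apply: leq_trans ic; rewrite -addSn leq_add2r.
  - move=> /t1[tcc rc]; have lv : lab v = 0.
      have [//|/(hanging_labelled Hg vG)[tv _]] := eqVneq (lab v) 0.
      by rewrite -tv -tc tcc.
    have [_ _ -> _] := hanging_unlabelled T lab_root Hg vG lv.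
    by rewrite -tc tcc.
  - move=> b; rewrite a9 a13 /upd; case: eqP => [_ _|_ /pst]; first exact: ltnSn.
    by move=> /ltnW.
rewrite /P; set s' := run _ _; set c := arr s' aDst l.
move=> [S' Edst Elab Enew [cG c0 c1 _ _]].
have lc : lab c != 0.
  apply/eqP => /c0[_ cn]; have [iu _] := st_idx S vG.
  have ci : 0 < arr s aIdx c := tree_idx T cG.
  have := leq_trans cn iu; lia.
split=> //; first by split=> //; exact: c1.
by move=> w lw /(Enew w lw)[].
Qed.

End Ear.

(** Both ends of the ear are already vertices of H here, so whatever the kind of step, only the
    addition of one edge is left. Seen from [rr u], the ear begins with [l]. *)
Lemma ear_progP G root s H u v e l :
  static G root s -> model_of G s H -> arr s aLab root != 0 ->
  (forall w, w \in vset G ->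
     hanging (arr s aLab) (arr s aPar) (arr s aTop) (arr s aRr) w) ->
  reg s rU = u -> reg s rV = v -> reg s rE = e -> reg s rL = l ->
  joins G e u v -> arr s aEs e = 0 -> arr s aTop u <> arr s aTop v ->
  (arr s aLab u = 0 -> arr s aPe u <> e) ->
  (arr s aLab v = 0 -> arr s aPe v <> e) ->
  arr s aLab (arr s aRr u) = 1 -> arr s aLab (arr s aRr v) = 1 ->
  l = (if arr s aLab u == 0 then arr s aPe (arr s aTop u) else e) ->
  let s' := run ear_prog s in
  [/\ exists2 H', add_edge l (arr s aRr u) (arr s aRr v) H H' & model_of G s' H',
      forall w, arr s aLab w != 0 -> arr s' aLab w = arr s aLab w,
      forall w, arr s aLab w = 0 -> arr s' aLab w != 1 &
      arr s aLab u = 0 -> arr s' aLab u != 0].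
Proof.
move=> S M lr Hg ru rv re rl j es0 tuv pu pv lx ly El.
have [uG vG] := joins_vset j.
have MS := model_sub M; rewrite -/(sub_of G s (eset H) id) in MS.
set lab := arr s aLab in lr Hg pu pv lx ly El *.
have esl : arr s aEs l = 0.
  rewrite El; case: eqP => [lu|//].
  have [tG lt _ _] := hanging_unlabelled (st_tree S) lr Hg uG lu.
  exact: (sub_tree MS).
have lH : l \notin eset H.
  by apply/negP => lH; have [_] := sub_link MS lH; rewrite esl.
have nol w : lab w <> l.+2.
  by move=> lw; have [] := sub_interior MS lw; rewrite (negbTE lH).
have pee w : w \in vset G -> lab w = 0 -> arr s aPe w <> e.
  move=> wG lw E; have [jw _] := tree_edge (st_tree S) wG (unlabelled_root lr lw).
  rewrite E in jw; case: (joins_uniq jw j) => -[E1 _].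
    by apply: pu; rewrite -E1.
  by apply: pv; rewrite -E1.
have := start_link MS (fun=> erefl) es0 lH j pee => S1.
rewrite /ear_prog run_seq.
set s1 := run start_prog s.
have [a14 a15 a11 [o1 c1]] : [/\ arr s1 aSrc = upd (arr s aSrc) l u,
    arr s1 aDst = upd (arr s aDst) l v, arr s1 aEs = upd (arr s aEs) e 1 &
    (forall a, a \notin [:: aSrc; aDst; aEs] -> arr s1 a = arr s a) /\
    [/\ reg s1 rL = l & reg s1 rC = e]].
  split; try by rewrite /s1 /= ?ru ?rv ?re ?rl.
  split; last by rewrite /s1 /= rl re.
  by move=> a aN; apply: run_arr; move: aN; rewrite /= !inE; lia.
have st1 : static G root s1 by apply: static_run.
have {}S1 : sub_of G s1 (l |` eset H) (upd id l (reg s1 rC)).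
  by rewrite /sub_of a14 a15 a11 !o1 // (proj2 c1).
have lab1 : arr s1 aLab = lab by rewrite o1.
move: s1 st1 a14 a15 a11 o1 c1 S1 lab1 => s1 st1 a14 a15 a11 o1 [l1 c1] S1 lab1.
have lL : l \in l |` eset H by rewrite !inE eqxx.
have Hg1 w : w \in vset G -> hanging lab (arr s1 aPar) (arr s aTop) (arr s aRr) w.
  by rewrite o1 //; apply: Hg.
have su : arr s1 aSrc l = u by rewrite a14 /upd eqxx.
have Cl : lab u != 0 -> reg s1 rC = l by move=> /negbTE lu; rewrite El lu c1.
have lpe : lab u = 0 -> l = arr s1 aPe (arr s aTop u).
  by move=> lu; rewrite El lu eqxx o1.
have := up_progP st1 lr Hg1 l1 lL uG lab1 su Cl lpe nol S1.
rewrite run_seq; set s2 := run _ s1 => -[[su2 so2] S2 L2 N2 U2].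
have st2 : static G root s2 by apply: static_run.
have K2 a : a \notin writes_arr up_step_prog -> arr s2 a = arr s1 a.
  exact: (@run_arr (PFor rJ false up_step_prog)).
have l2 : reg s2 rL = l by rewrite -l1; apply: run_reg.
move: s2 st2 su2 so2 S2 L2 N2 U2 K2 l2 => s2 st2 su2 so2 S2 L2 N2 U2 K2 l2.
rewrite run_seq; set s3 := run _ s2.
have st3 : static G root s3 by apply: static_run.
have [r3 l3 A3] : [/\ reg s3 rQ = (reg s2 0).+1, reg s3 rL = l & arr s3 = arr s2] by [].
move: s3 st3 r3 l3 A3 => s3 st3 r3 l3 A3.
have Hg3 w : w \in vset G -> hanging lab (arr s3 aPar) (arr s aTop) (arr s aRr) w.
  by rewrite A3 K2 //; apply: Hg1.
have dv : arr s3 aDst l = v by rewrite A3 K2 // a15 /upd eqxx.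
have L3 w : lab w != 0 -> arr s3 aLab w = lab w by rewrite A3; apply: L2.
have N3 w : lab w = 0 -> arr s3 aLab w != 0 -> arr s aTop w = arr s aTop u.
  by rewrite A3 => lw /(N2 w lw)[].
have q3 : 0 < reg s3 rQ by rewrite r3.
have p3 b : arr s3 aLab b = l.+2 -> arr s3 aPos b < reg s3 rQ.
  rewrite A3 r3 => lb; have [lb0|lb0] := eqVneq (lab b) 0.
    have [|_ _ ->] := N2 b lb0; first by rewrite lb.
    have bG : b \in vset G by apply: (sub_vset S2); rewrite lb.
    by rewrite -(K2 aIdx) // ltnS; case: (st_idx st2 bG).
  by case: (nol b); rewrite -L2.
have S3 : sub_of G s3 (l |` eset H) id by rewrite /sub_of A3.
have := down_progP st3 lr Hg3 l3 lL vG dv tuv L3 N3 q3 p3 S3.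
set s4 := run _ s3 => -[[dv4 do4] S4 L4 N4].
have K4 a : a \notin writes_arr down_step_prog -> arr s4 a = arr s3 a.
  exact: (@run_arr (PFor rJ false down_step_prog)).
move: s4 dv4 do4 S4 L4 N4 K4 => s4 dv4 do4 S4 L4 N4 K4.
have old w : lab w != 0 -> arr s4 aLab w = lab w.
  by move=> lw; rewrite L4 L3.
have new w : lab w = 0 -> arr s4 aLab w != 1.
  move=> lw; have [E|lw3] := eqVneq (arr s3 aLab w) 0.
    by have [->//|/(N4 w E) ->] := eqVneq (arr s4 aLab w) 0.
  by rewrite A3 in lw3; rewrite L4 A3 //; have [->] := N2 w lw lw3.
split=> //; last first.
  move=> lu; have u3 : arr s3 aLab u != 0 by rewrite A3 U2.
  by rewrite L4.
have pe4 : arr s4 aPe = arr s aPe by rewrite K4 // A3 K2 // o1.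
rewrite /sub_of pe4 in S4.
rewrite /model_of pe4.
apply: (add_edge_model M lH lx ly _ _ _ dv4 _ S4) => //.
- move=> w; have [lw|lw] := eqVneq (lab w) 0; last by rewrite old.
  by rewrite -/lab lw (negbTE (new w lw)).
- move=> g gH; have gl : g != l by apply: contraNneq lH => <-.
  rewrite K4 // A3 so2 // do4 // A3 K2 // a14 a15 /upd (negbTE gl); by split.
- by rewrite K4 // A3.
Qed.

(** * One round *)

(** The output follows the argument order of the constructors: after the tag, each [split_prog]
    emits the six arguments of its division, and the rest comes last. *)
Definition code_prog : prog :=
  PIf (TestEq aLab.{Reg rX} (Const 1))
    (POut (Const 0) ;; POut (Reg rL) ;; POut (Reg rX) ;; POut (Reg rY))
    (PIf (TestEq aLab.{Reg rY} (Const 1))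
      (POut (Const 1) ;; split_prog rX ;; POut (Reg rL) ;; POut (Reg rY))
      (POut (Const 2) ;; split_prog rX ;; split_prog rY ;; POut (Reg rL))).

(** When the code is output the step is still unfinished, so that it is an extension can only be
    claimed for those [H'] that the ear will complete. *)
Lemma code_progP G root s H x y l :
  static G root s -> model_of G s H ->
  reg s rX = x -> reg s rY = y -> reg s rL = l ->
  arr s aLab x != 0 -> arr s aLab y != 0 ->
  (1 < arr s aLab x) && (arr s aLab x != arr s aLab y)
    || (arr s aLab x == 1) && (arr s aLab y == 1) ->
  let s' := run code_prog s in
  exists H1 o, [/\ model_of G s' H1 /\ arr s' aLab x = 1 /\ arr s' aLab y = 1,
    forall H', add_edge l x y H1 H' -> one_edge_extension H o H',
    out s' = out s ++ extension_code o,
    forall w, (arr s' aLab w == 0) = (arr s aLab w == 0) /\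
      (arr s aLab w = 1 -> arr s' aLab w = 1) &
    forall e, arr s aEs e = 0 -> arr s' aEs e = 0].
Proof.
move=> S M rx ry rl lx0 ly0 lxy.
rewrite /code_prog run_if.
have -> : holds s (TestEq aLab.{Reg rX} (Const 1)) = (arr s aLab x == 1) by rewrite /= rx.
have [lx|lx] := eqVneq (arr s aLab x) 1.
  have ly : arr s aLab y = 1 by apply/eqP; move: lxy; rewrite lx /=.
  exists H, (ExtA l x y); split=> //.
  by rewrite /= rx ry rl -!cats1 -!catA.
have {lxy}/andP[lx1 lxy] : (1 < arr s aLab x) && (arr s aLab x != arr s aLab y).
  by move: lxy; rewrite (negbTE lx) orbF.
have [g lg] : exists g, arr s aLab x = g.+2.
  by case: (arr s aLab x) lx1 => [//|[//|g]] _; exists g.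
have xy : x != y by apply: contraNneq lxy => ->.
rewrite run_if.
have -> : holds s (TestEq aLab.{Reg rY} (Const 1)) = (arr s aLab y == 1) by rewrite /= ry.
have [xG [gH esx]] : x \in vset G /\ g \in eset H /\ arr s aEs (arr s aNxt x) = x.+2.
  have MS := model_sub M; have [gH _ _ ex] := sub_interior MS lg.
  by split=> //; apply: (sub_vset MS); rewrite lg.
have [ly|ly] := eqVneq (arr s aLab y) 1.
  rewrite run_seq; set s1 := run (POut (Const 1)) s.
  have O1 : out s1 = out s ++ [:: 1] by rewrite cats1.
  have M1 : model_of G s1 H by [].
  have S1 : static G root s1 by apply: static_run.
  have [R1 A1] : reg s1 = reg s /\ arr s1 = arr s by [].
  move: s1 O1 M1 S1 R1 A1 => s1 O1 M1 S1 R1 A1.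
  rewrite run_seq; set s2 := run (split_prog rX) s1.
  have [] := @split_progP G root s1 H rX x g S1 M1; rewrite ?R1 ?A1 //.
  rewrite -/s2 => -[H1 [D EL M2]] O2 L2 E2.
  have [l2 y2] : reg s2 rL = l /\ reg s2 rY = y.
    by rewrite /s2 !run_reg // R1.
  move: s2 M2 O2 L2 E2 l2 y2 => s2 M2 O2 L2 E2 l2 y2.
  exists H1, (ExtB g (arr s aSrc g) (arr s aDst g) g (arr s aNxt x) x l y).
  split; [split; [exact: M2|]| | | |].
  - by rewrite /= !L2 eqxx eq_sym (negbTE xy) ly.
  - move=> H' AE; split; last by exists H1.
    by rewrite (model_vset M) ly.
  - by rewrite /= O2 O1 l2 y2 -!cats1 -!catA.
  - move=> w; rewrite /= L2; have [->|wx] := eqVneq w x.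
      by rewrite (negbTE lx0); split=> // E; rewrite E in lx.
    case: ifP => // /andP[/eqP -> _]; by split.
  - move=> e e0; rewrite /= E2 /upd; case: eqP => // E.
    by rewrite E esx in e0.
have [g' lg'] : exists g, arr s aLab y = g.+2.
  by case: (arr s aLab y) ly0 ly => [//|[//|i]] _ _; exists i.
rewrite run_seq; set s1 := run (POut (Const 2)) s.
have O1 : out s1 = out s ++ [:: 2] by rewrite cats1.
have M1 : model_of G s1 H by [].
have S1 : static G root s1 by apply: static_run.
have [R1 A1] : reg s1 = reg s /\ arr s1 = arr s by [].
move: s1 O1 M1 S1 R1 A1 => s1 O1 M1 S1 R1 A1.
rewrite run_seq; set s2 := run (split_prog rX) s1.
have [] := @split_progP G root s1 H rX x g S1 M1; rewrite ?R1 ?A1 //.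
rewrite -/s2 => -[H1 [D EL M2]] O2 L2 E2.
have [l2 y2] : reg s2 rL = l /\ reg s2 rY = y.
  by rewrite /s2 !run_reg // R1.
have S2 : static G root s2 by apply: static_run.
move: s2 M2 O2 L2 E2 l2 y2 S2 => s2 M2 O2 L2 E2 l2 y2 S2.
(* [y] is not on the link [g], so the first division does not relabel it. *)
have ly2 : arr s2 aLab y = g'.+2.
  rewrite L2 eq_sym (negbTE xy); case: eqP => // E.
  by rewrite lg -E eqxx in lxy.
rewrite run_seq; set s3 := run (split_prog rY) s2.
have [] := @split_progP G root s2 H1 rY y g' S2 M2; rewrite ?y2 //.
rewrite -/s3 => -[H2 [D2 EL2 M3]] O3 L3 E3.
have l3 : reg s3 rL = l by rewrite /s3 !run_reg.
have esy : arr s2 aEs (arr s2 aNxt y) = y.+2.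
  by have [] := sub_interior (model_sub M2) ly2.
have g'H : g' \in eset H.
  by have [] := sub_interior (model_sub M) lg'.
move: s3 M3 O3 L3 E3 l3 => s3 M3 O3 L3 E3 l3.
exists H2, (ExtC g (arr s aSrc g) (arr s aDst g) g (arr s aNxt x) x
  g' (arr s2 aSrc g') (arr s2 aDst g') g' (arr s2 aNxt y) y l).
split; [split; [exact: M3|]| | | |].
- by rewrite /= !L3 eqxx (negbTE xy) !(L2 x) eqxx.
- move=> H' AE; split; last by exists H1, H2.
  by split=> //; apply: contraNneq lxy => E; rewrite lg lg' E.
- by rewrite /= O3 O2 O1 l3 -!cats1 -!catA.
- move=> w; rewrite /= L3; have [->|wy] := eqVneq w y.
    by rewrite (negbTE ly0); split=> // E; rewrite E in ly.
  have -> : (if (arr s2 aLab w == g'.+2) && (arr s2 aPos y < arr s2 aPos w)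
     then (arr s2 aNxt y).+2 else arr s2 aLab w) == 0 = (arr s2 aLab w == 0).
    by case: ifP => // /andP[/eqP -> _].
  rewrite L2; have [->|wx] := eqVneq w x.
    by rewrite (negbTE lx0) /=; split=> // E; rewrite E in lx.
  split; first by case: ifP => // /andP[/eqP -> _].
  by move=> ->.
- move=> e e0; rewrite /= E3 /upd; case: eqP => [E|_]; last first.
    by rewrite E2 /upd; case: eqP => // E; rewrite E esx in e0.
  move: esy; rewrite -E E2 /upd; case: eqP => // _; by rewrite e0.
Qed.

Definition running (G : graph) (root : nat) (s : state) (H : graph) : Prop :=
  [/\ static G root s, model_of G s H, arr s aLab root = 1 &
      exists G0 t, topological_extension_sequence root G0 t H /\
        out s = sequence_code root t].

Lemma extension_step root G0 t H o H' :
  topological_extension_sequence root G0 t H -> one_edge_extension H o H' ->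
  topological_extension_sequence root G0 (rcons t (o, H')) H' /\
  sequence_code root (rcons t (o, H')) = sequence_code root t ++ extension_code o.
Proof.
move=> [V0 E0 ch la] ex; split; last first.
  by rewrite /sequence_code /unzip1 map_rcons map_rcons flatten_rcons.
split=> //; last by rewrite /unzip2 map_rcons last_rcons.
elim: t G0 {V0 E0} ch la => [|[o' H1] t IH] G0 /=; first by move=> _ ->.
by move=> [ex1 ch] la; split=> //; apply: IH.
Qed.

(** Membership in S plus membership in H: the total is at most 2n and grows with every ear. *)
Definition weight (l : nat) : nat := (l != 0) + (l == 1).

Definition progress (G : graph) (s : state) : nat :=
  \sum_(v <- vset G) weight (arr s aLab v).

Lemma ltn_sum_seq (r : seq nat) (F F' : nat -> nat) z :
  z \in r -> F z < F' z -> (forall w, F w <= F' w) ->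
  \sum_(w <- r) F w < \sum_(w <- r) F' w.
Proof.
move=> zr lt le; rewrite !(big_rem z zr) /=.
by rewrite -addSn leq_add // leq_sum.
Qed.

Definition load_prog : prog :=
  PSet rU aTail.{Pred (Reg rF)} ;; PSet rV aHead.{Pred (Reg rF)} ;;
  PSet rE aEdge.{Pred (Reg rF)} ;;
  PSet rX aRr.{Reg rU} ;; PSet rY aRr.{Reg rV} ;;
  PIf (is_zero aLab.{Reg rU}) (PSet rL aPe.{aTop.{Reg rU}}) (PSet rL (Reg rE)).

Definition extend_prog : prog := load_prog ;; code_prog ;; ear_prog.

Lemma extend_progP G root s H :
  running G root s H ->
  (forall w, w \in vset G ->
     hanging (arr s aLab) (arr s aPar) (arr s aTop) (arr s aRr) w) ->
  reg s rF != 0 -> (reg s rF).-1 < reg s 1 -> good_entry s (reg s rF).-1 ->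
  let s' := run extend_prog s in
  exists2 H', running G root s' H' & progress G s < progress G s'.
Proof.
move=> [S M lr [G0 [t [ts Ot]]]] Hg f0; set p := (reg s rF).-1 => pM.
rewrite /good_entry; set u := arr s aTail p; set v := arr s aHead p.
set e := arr s aEdge p; rewrite /good_edge.
set x := arr s aRr u; set y := arr s aRr v.
move=> /and5P[/eqP es0 pu pv /eqP tuv gxy].
have j : joins G e u v := entry_joins (st_entries S) pM.
have [uG vG] := joins_vset j.
have lr0 : arr s aLab root != 0 by rewrite lr.
have [xG lx0] := hanging_rr (st_tree S) lr0 Hg uG.
have [yG ly0] := hanging_rr (st_tree S) lr0 Hg vG.
rewrite -/x -/y in xG lx0 yG ly0.
rewrite /extend_prog run_seq; set s1 := run load_prog s.
pose l := if arr s aLab u == 0 then arr s aPe (arr s aTop u) else e.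
have [[u1 v1 e1 x1 y1] l1] : [/\ reg s1 rU = u, reg s1 rV = v, reg s1 rE = e,
    reg s1 rX = x & reg s1 rY = y] /\ reg s1 rL = l.
  rewrite /s1 /load_prog /= -/p -/u -/v -/e -/x -/y /l.
  by case: (arr s aLab u == 0).
have A1 : arr s1 = arr s by rewrite /s1 /load_prog /=; case: ifP.
have O1 : out s1 = out s by apply: run_out.
have S1 : static G root s1 by apply: static_run.
move: s1 u1 v1 e1 x1 y1 l1 A1 O1 S1 => s1 u1 v1 e1 x1 y1 l1 A1 O1 S1.
have M1 : model_of G s1 H by rewrite /model_of A1.
rewrite run_seq; set s2 := run code_prog s1.
have [] := @code_progP G root s1 H x y l S1 M1 x1 y1 l1; rewrite ?A1 //.
  by case/orP: gxy => [-> //|/and3P[-> -> _]]; rewrite orbT.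
rewrite -/s2 => H1 [o [[M2 [lx2 ly2]] ext O2 L2 E2]].
have S2 : static G root s2 by apply: static_run.
have [u2 v2 e2 l2] : [/\ reg s2 rU = u, reg s2 rV = v, reg s2 rE = e &
    reg s2 rL = l] by rewrite /s2 !run_reg.
have [K7 K8 K10 K16] : [/\ arr s2 aPar = arr s aPar, arr s2 aPe = arr s aPe,
    arr s2 aTop = arr s aTop & arr s2 aRr = arr s aRr].
  by rewrite /s2 !(@run_arr code_prog) // A1.
have L20 w : arr s2 aLab w == 0 = (arr s aLab w == 0) by case: (L2 w).
have L21 w : arr s aLab w = 1 -> arr s2 aLab w = 1 by case: (L2 w).
move: s2 u2 v2 e2 l2 M2 lx2 ly2 O2 L2 E2 S2 K7 K8 K10 K16 L20 L21 =>
  s2 u2 v2 e2 l2 M2 lx2 ly2 O2 L2 E2 S2 K7 K8 K10 K16 L20 L21.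
have Hg2 w : w \in vset G ->
     hanging (arr s2 aLab) (arr s2 aPar) (arr s2 aTop) (arr s2 aRr) w.
  by move=> /Hg; rewrite /hanging !L20 K7 K10 K16.
have := @ear_progP G root s2 H1 u v e l S2 M2; rewrite K8 K10 K16 L20.
case=> //.
- by move=> w /Hg2; rewrite K10 K16.
- by apply: E2.
- by move/eqP; rewrite L20 => lu; move: pu; rewrite lu => /eqP.
- by move/eqP; rewrite L20 => lv; move: pv; rewrite lv => /eqP.
- by rewrite L20.
set s3 := run _ s2 => -[H' AE M3] L3 N3 U3.
have S3 : static G root s3 by apply: static_run.
exists H'.
  split=> //; first by rewrite L3 L21.
  exists G0, (rcons t (o, H')).
  have [ts' ->] := extension_step ts (ext H' AE); split=> //.
  by rewrite /s3 run_out // O2 O1 Ot.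
have wle w : weight (arr s aLab w) <= weight (arr s3 aLab w).
  rewrite /weight; have [->//|lw] := eqVneq (arr s aLab w) 0.
  have lw2 : arr s2 aLab w != 0 by rewrite L20.
  rewrite L3 // lw2; have [lw1|_] := eqVneq (arr s aLab w) 1.
    by rewrite L21.
  by case: (_ == _).
(* In the first case [x] passes from the interior of a link to H, in the second [u] enters S. *)
case/orP: gxy => [/andP[lx1 _]|/and3P[_ _ /eqP lu]].
  apply: ltn_sum_seq xG _ wle; rewrite /weight L3 lx2 // lx0.
  by move: lx1; rewrite ltn_neqAle eq_sym => /andP[/negbTE ->].
apply: ltn_sum_seq uG _ wle; rewrite /weight lu.
have U0 : arr s2 aLab u = 0 by apply/eqP; rewrite L20 lu.
by have := U3 U0 => /= ->.
Qed.

Definition round_prog : prog :=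
  sweep_prog ;; scan_prog ;; PIf (is_zero (Reg rF)) PSkip extend_prog.

(** If the scan finds nothing, the two existence lemmas for good edges exclude first interior
    vertices and then vertices outside S. *)
Lemma round_progP G root s H :
  three_edge_connected G -> running G root s H ->
  let s' := run round_prog s in
  exists2 H', running G root s' H' &
    progress G s < progress G s' \/ forall v, v \in vset G -> arr s' aLab v = 1.
Proof.
move=> G3 [S M lr OT].
have lr0 : arr s aLab root != 0 by rewrite lr.
rewrite /round_prog run_seq; set s1 := run sweep_prog s.
have Hg := sweep_progP S lr0; rewrite -/s1 in Hg.
have K1 a : a \notin writes_arr sweep_prog -> arr s1 a = arr s a by apply: run_arr.
have O1 : out s1 = out s by apply: run_out.
have S1 : static G root s1 by apply: static_run.
move: s1 Hg K1 O1 S1 => s1 Hg K1 O1 S1.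
rewrite run_seq; set s2 := run scan_prog s1.
have := scan_progP s1; rewrite -/s2; lazy zeta.
have A2 : arr s2 = arr s1.
  by rewrite /s2 /scan_prog run_seq; set s0 := run _ s1;
     apply: (@iteri_ind _ (fun _ st => arr st = arr s1)) => //= k st _ E;
     rewrite -E /set_reg /=; case: ifP.
have R2 : reg s2 1 = reg s1 1 by apply: run_reg.
have O2 : out s2 = out s by rewrite -O1; apply: run_out.
have S2 : static G root s2 by apply: static_run.
move: s2 A2 R2 O2 S2 => s2 A2 R2 O2 S2; rewrite run_if.
have -> : holds s2 (is_zero (Reg rF)) = (reg s2 rF == 0) by [].
have Run2 : running G root s2 H.
  by split=> //; rewrite ?A2 /model_of ?A2 ?K1 // O2.
have Hg2 w : w \in vset G ->
     hanging (arr s2 aLab) (arr s2 aPar) (arr s2 aTop) (arr s2 aRr) w.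
  by move=> /Hg; rewrite A2 !(K1 9, K1 7).
have lr2 : arr s2 aLab root != 0 by rewrite A2 K1.
have M2 : model_of G s2 H by case: Run2.
have [f0|f0] := eqVneq (reg s2 6) 0.
  move=> bad; exists H => //; right.
  have nogood e u v : joins G e u v ->
      ~ good_edge (arr s2 aLab) (arr s2 aEs) (arr s2 aPe) (arr s2 aTop) (arr s2 aRr) e u v.
    move=> j g; have [p pM [E1 E2 E3]] := entry_pos (st_entries S2) j.
    have := bad p; rewrite -R2 => /(_ pM); rewrite /good_entry -A2 E1 E2 E3.
    by rewrite g.
  have lab1 a : arr s2 aLab a <= 1.
    rewrite leqNgt; apply/negP => la.
    have [e [u [v [j g]]]] : exists e u v, joins G e u v /\ good_edge (arr s2 aLab)
      (arr s2 aEs) (arr s2 aPe) (arr s2 aTop) (arr s2 aRr) e u v.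
      apply: (good_edge_interior (st_tree S2) lr2 Hg2 M2 G3 la).
      by rewrite A2 K1.
    exact: nogood j g.
  move=> v vG; have := lab1 v; case E: (arr s2 aLab v) => [|[|//]] // _.
  have [e [u [w [j g]]]] := good_edge_uncovered (st_tree S2) lr2 Hg2 M2 G3 lab1 vG E.
  by case: (nogood _ _ _ j g).
move=> [fM gf]; have [||H' Run' pr] := extend_progP Run2 Hg2 f0.
- by rewrite R2.
- by rewrite /good_entry A2.
exists H' => //; left.
by move: pr; rewrite {1}/progress A2 K1.
Qed.

(** * The whole program *)

(** An edge that is not a loop occurs in two entries; marking it in [aEs] makes the second one be
    skipped. *)
Definition finish_step_prog : prog :=
  PIf (is_zero aEs.{aEdge.{Reg rJ}})
    (PSto aEs aEdge.{Reg rJ} (Const 1) ;;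
     PSto aSrc aEdge.{Reg rJ} aTail.{Reg rJ} ;;
     PSto aDst aEdge.{Reg rJ} aHead.{Reg rJ} ;;
     POut (Const 0) ;; POut aEdge.{Reg rJ} ;;
     POut aTail.{Reg rJ} ;; POut aHead.{Reg rJ})
    PSkip.

Definition init_prog : prog :=
  PSto aLab aVert.{Const 0} (Const 1) ;; POut aVert.{Const 0}.

Definition main_prog : prog :=
  tails_prog ;; tree_prog ;; init_prog ;;
  PFor rI false (round_prog ;; round_prog) ;;
  PFor rJ true finish_step_prog.

Lemma running_set_reg G root s H x k : 1 < x -> running G root s H ->
  running G root (set_reg s x k) H.
Proof.
move=> x1 [[S1 S2 S3 S4 S5] M lr OT]; split=> //.
by split; rewrite /= ?(ltn_eqF (ltnW x1)) ?(ltn_eqF x1).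
Qed.

Lemma finish_stepP G root s H k :
  running G root s H -> (forall v, v \in vset G -> arr s aLab v = 1) ->
  reg s rJ = k -> k < reg s 1 ->
  let s' := run finish_step_prog s in
  [/\ exists H', running G root s' H', arr s' aLab = arr s aLab,
      arr s' aEs (arr s aEdge k) != 0 &
      forall e, arr s aEs e != 0 -> arr s' aEs e != 0].
Proof.
move=> [S M lr [G0 [t [ts Ot]]]] lab1 sk kM.
rewrite /finish_step_prog run_if.
have -> : holds s (is_zero aEs.{aEdge.{Reg rJ}}) = (arr s aEs (arr s aEdge k) == 0).
  by rewrite /= sk.
set e := arr s aEdge k; set u := arr s aTail k; set v := arr s aHead k.
have j : joins G e u v := entry_joins (st_entries S) kM.
have [uG vG] := joins_vset j.
have [e0|e0] := eqVneq (arr s aEs e) 0; last first.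
  by split=> //; exists H; split=> //; exists G0, t.
set s1 := run _ s.
have [a11 a14 a15 O1] : [/\ arr s1 aEs = upd (arr s aEs) e 1,
   arr s1 aSrc = upd (arr s aSrc) e u, arr s1 aDst = upd (arr s aDst) e v &
   out s1 = out s ++ [:: 0; e; u; v]].
  by rewrite /s1 /= sk -!cats1 -!catA; split.
have A1 : [/\ arr s1 aLab = arr s aLab, arr s1 aPos = arr s aPos,
  arr s1 aNxt = arr s aNxt & arr s1 aPe = arr s aPe] by [].
have S1 : static G root s1 by apply: static_run.
move: s1 a11 a14 a15 O1 A1 S1 => s1 a11 a14 a15 O1 [a9 a13 a12 a8] S1.
have MS := model_sub M.
have eH : e \notin eset H.
  by apply/negP => eH; have [_] := sub_link MS eH; rewrite /= e0.
have nol w : w \in vset G -> arr s aLab w = 0 -> arr s aPe w <> e.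
  by move=> wG; rewrite lab1.
have Sub := start_link MS (fun=> erefl) e0 eH j nol.
have [H' AE M'] : exists2 H', add_edge e u v H H' & model_of G s1 H'.
  rewrite /model_of a8 a9 a13 a12 a14 a15 a11.
  apply: (add_edge_model M eH (lab1 u uG) (lab1 v vG) _ _ _ _ _ Sub) => //.
  - move=> g gH; have ge : g != e by apply: contraNneq eH => <-.
    by rewrite /upd (negbTE ge).
  - by rewrite /upd eqxx.
  - by rewrite /upd eqxx.
  - by move=> g; rewrite /upd; case: eqP.
split=> //.
- exists H'; split=> //; first by rewrite a9.
  exists G0, (rcons t (ExtA e u v, H')).
  have [ts' ->] := @extension_step _ _ _ _ (ExtA e u v) _ ts AE.
  by split=> //; rewrite O1 Ot.
- by rewrite a11 /upd eqxx.
- by move=> e' e'0; rewrite a11 /upd; case: (e' == e).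
Qed.

Lemma finish_progP G root s H :
  running G root s H -> (forall v, v \in vset G -> arr s aLab v = 1) ->
  running G root (run (PFor rJ true finish_step_prog) s) G.
Proof.
move=> R0 lab1.
pose P k st := [/\ exists H, running G root st H,
  forall v, v \in vset G -> arr st aLab v = 1 &
  forall p, p < k -> arr st aEs (arr s aEdge p) != 0].
have : P (reg s 1) (run (PFor rJ true finish_step_prog) s).
  apply: (@run_for P rJ true) => [|k st kM Ek EA EX [[H1 R1] L1 E1]].
    by split=> //; exists H; apply: running_set_reg.
  have kM' : k < reg st 1 by rewrite EX.
  have [[H2 R2] L2 E2 E3] := finish_stepP R1 L1 Ek kM'.
  have A2 : arr st aEdge = arr s aEdge by rewrite EA.
  rewrite A2 in E2.
  move: (run _ st) R2 L2 E2 E3 => s2 R2 L2 E2 E3; split.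
  - by exists H2; apply: running_set_reg.
  - by move=> v vG; rewrite /= L2 L1.
  - move=> p; rewrite ltnS leq_eqVlt => /predU1P[->|pk]; first exact: E2.
    by apply: E3; apply: E1.
set s' := run _ s => -[[H' R'] L' E'].
have Es : forall e, e \in eset G -> arr s' aEs e != 0.
  move=> e /eset_joins[u [v j]]; have [S _ _ _] := R0.
  by have [p pM [<- _ _]] := entry_pos (st_entries S) j; apply: E'.
have [_ M _ _] := R'.
by have E := model_complete M L' Es; rewrite E in R'.
Qed.

(** Memory beyond the input and the tree is still 0, which already encodes an S without edges; only
    the root has to be labelled. *)
Lemma init_progP G root s :
  static G root s -> arr s aVert 0 = root -> out s = [::] ->
  (forall a w, 8 < a -> arr s a w = 0) ->
  exists H, running G root (run init_prog s) H /\
    0 < progress G (run init_prog s).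
Proof.
move=> S sr Os A0; have rG := tree_root (st_tree S).
have wf : [forall e : domf ([fmap] : {fmap nat -> {fset nat}}),
    (([fmap] : {fmap nat -> {fset nat}}) e `<=` [fset root])
    && (0 < #|` ([fmap] : {fmap nat -> {fset nat}}) e| <= 2)].
  by apply/forallP => -[e eD]; have := eD; rewrite inE.
set s1 := run init_prog s.
have [L1 A1 O1] : [/\ forall w, arr s1 aLab w = (w == root),
   forall a, a != aLab -> arr s1 a = arr s a & out s1 = [:: root]].
  rewrite /s1 /=; split; last by rewrite Os sr.
    by move=> w; rewrite sr A0 //; case: eqP.
  by move=> a /negbTE a9; rewrite a9.
have S1 : static G root s1 by apply: static_run.
move: s1 L1 A1 O1 S1 => s1 L1 A1 O1 S1.
exists (Graph wf); split; last first.
  by rewrite /progress (big_rem root) //= L1 eqxx.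
split=> //; last 2 first.
- by rewrite L1 eqxx.
- exists (Graph wf), [::]; split; last by rewrite O1.
  by split=> //; rewrite /eset /= domf0.
split.
- by move=> v; rewrite L1 /= inE; case: eqP.
- by move=> g; rewrite /eset /= inE.
split.
- by move=> w; rewrite L1; have [->|] := eqVneq w root.
- by move=> a g; rewrite L1; case: eqP.
- by move=> g; rewrite /eset /= inE.
- by move=> a b g; rewrite L1; case: eqP.
- by move=> e; rewrite A1 // A0.
- by [].
- by move=> e a; rewrite A1 // A0.
- by move=> w _ _; rewrite A1 // A0.
Qed.

(** Two rounds per pass make 2n rounds. A progress that starts above 0 and never exceeds 2n cannot
    grow in all of them. *)
Lemma rounds_progP G root s H : three_edge_connected G ->
  running G root s H -> 0 < progress G s -> reg s 0 = #|` vset G| ->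
  let s' := run (PFor rI false (round_prog ;; round_prog)) s in
  exists2 H', running G root s' H' &
    forall v, v \in vset G -> arr s' aLab v = 1.
Proof.
move=> G3 R0 p0 sn.
pose ok k st := k < progress G st \/ forall v, v \in vset G -> arr st aLab v = 1.
have step k st H1 : running G root st H1 -> ok k st ->
    exists2 H2, running G root (run round_prog st) H2 & ok k.+1 (run round_prog st).
  move=> R1 O1; have [H2 R2 pr] := round_progP G3 R1; exists H2 => //.
  move: (run round_prog st) R2 pr => st' R2 pr.
  case: pr => [lt|]; last by right.
  (* When all labels are 1 the progress is maximal, so a further round cannot increase it and must
     end in the other alternative. *)
  case: O1 => [kp|full]; first by left; apply: leq_ltn_trans lt.
  exfalso; move: lt; rewrite ltnNge => /negP; apply.
  rewrite /progress !big_seq; apply: leq_sum => v vG.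
  by rewrite [in X in _ <= X]/weight (full v vG); rewrite /weight; case: (arr st' aLab v) => [|[|]].
pose P k st := exists2 H1, running G root st H1 & ok k.*2 st.
have : P (reg s 0) (run (PFor rI false (round_prog ;; round_prog)) s).
  apply: (@run_for P rI false) => [|k st kN Ek EA EX [H1 R1 O1]].
    by exists H; [apply: running_set_reg | left].
  have [H2 R2 O2] := step _ _ _ R1 O1; rewrite run_seq.
  move: (run round_prog st) R2 O2 => st2 R2 O2.
  have [H3 R3 O3] := step _ _ _ R2 O2.
  by exists H3; [apply: running_set_reg | rewrite doubleS].
set s' := run _ s => -[H1 R1 O1]; exists H1 => //.
case: O1 => // lt; exfalso; move: lt; rewrite sn ltnNge => /negP; apply.
rewrite /progress -muln2; apply: (@leq_trans (\sum_(v <- vset G) 2)).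
  by apply: leq_sum => v _; rewrite /weight; case: (arr s' aLab v) => [|[|]].
by rewrite big_const_seq count_predT iter_addn_0 mulnC.
Qed.

Lemma main_progP G L : three_edge_connected G -> adjacency_list_of G L ->
  let s := set_reg (input_state L) 1 (arr (input_state L) aOff (size L)) in
  exists root, running G root (run main_prog s) G.
Proof.
move=> G3 LG; have nG := input_size LG.
have [uL EV jL] := LG; have [Gc _] := G3.
set s := set_reg _ _ _; rewrite /main_prog run_seq.
have offS i : i < reg s 0 -> arr s aOff i <= arr s aOff i.+1.
  by move=> iL; rewrite [X in _ <= X](input_offsetS (L := L)) // leq_addr.
set s1 := run tails_prog s.
have A1 a : a != aTail -> arr s1 a = arr s a.
  by move=> a4; apply: run_arr; rewrite /= inE.
have R1 x : x <= 1 -> reg s1 x = reg s x.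
  by move=> x1; apply: run_reg; rewrite /= !inE; lia.
have O1 : out s1 = [::] by rewrite /s1 run_out.
have T1 : forall i p, i < size L -> p < arr (input_state L) aOff (size L) ->
     arr (input_state L) aOff i <= p < arr (input_state L) aOff i.+1 ->
     arr s1 aTail p = nth 0 (unzip1 L) i.
  exact: tails_progP offS.
have E1 : entry_list G (arr s1 aTail) (arr s1 aEdge) (arr s1 aHead) (reg s1 1).
  rewrite R1 //; apply: (input_entries LG) T1; by rewrite A1.
move: s1 A1 R1 O1 T1 E1 => s1 A1 R1 O1 T1 E1.
set root := arr s1 aVert 0.
have n0 : 0 < size L.
  rewrite -nG cardfs_gt0; by case: Gc.
have rootE : root = nth 0 (unzip1 L) 0 by rewrite /root A1.
have rG : root \in vset G by rewrite -EV rootE mem_nth // size_map.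
have n1 : reg s1 0 = #|` vset G| by rewrite R1 // nG.
have i1 w : arr s1 aIdx w = 0 by rewrite A1.
have := tree_progP Gc E1 i1 rG n1; rewrite run_seq.
set s2 := run tree_prog s1; lazy zeta => -[T2 [ord2 idx2]].
have A2 a : a \notin [:: 5; 6; 7; 8] -> arr s2 a = arr s1 a.
  by move=> aN; apply: run_arr; move: aN; rewrite /= !inE; lia.
have R2 x : x <= 1 -> reg s2 x = reg s1 x.
  by move=> x1; apply: run_reg; rewrite /= !inE; lia.
have O2 : out s2 = [::] by rewrite /s2 run_out.
have S2 : static G root s2.
  split; rewrite ?R2 // ?(A2 4) ?(A2 3) ?(A2 2) ?(A2 0) //.
  move=> w; rewrite -EV => wL; exists (index w (unzip1 L)).
    by rewrite n1 nG -(size_map fst) index_mem.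
  by rewrite A1 //= nth_index.
have Z2 a w : 8 < a -> arr s2 a w = 0.
  move=> a8; rewrite A2 ?A1 ?inE; [|lia|lia].
  by move: a8; do 9 case: a => [//|a].
have r2 : arr s2 aVert 0 = root by rewrite A2.
have n2 : reg s2 0 = #|` vset G| by rewrite R2.
move: s2 T2 ord2 idx2 A2 R2 O2 S2 Z2 r2 n2 => s2 _ _ _ _ _ O2 S2 Z2 r2 n2.
have [H3 [Run3 p3]] := init_progP S2 r2 O2 Z2.
rewrite run_seq.
have n3 : reg (run init_prog s2) 0 = #|` vset G| by rewrite run_reg.
move: (run init_prog s2) n3 Run3 p3 => s3 n3 Run3 p3.
have [H4 Run4 L4] := rounds_progP G3 Run3 p3 n3.
rewrite run_seq; move: (run (PFor _ _ _) s3) Run4 L4 => s4 Run4 L4.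
by exists root; apply: finish_progP Run4 L4.
Qed.

(** * Running time and conclusion *)

(** Vertices other than the root have distinct tree edges. This is what absorbs the n * n of the
    nested vertex loops into the bound. *)
Lemma spanning_tree_card G root par pe idx : spanning_tree G root par pe idx ->
  #|` vset G| <= #|` eset G|.+1.
Proof.
move=> T; rewrite (cardfsD1 root) (tree_root T) add1n ltnS.
rewrite -(size_map pe); apply: uniq_leq_size.
  rewrite map_inj_in_uniq ?fset_uniq // => w w'; rewrite !inE.
  by move=> /andP[wr wG] /andP[wr' wG']; apply: (tree_edge_inj T).
move=> e /mapP[w]; rewrite !inE => /andP[wr wG] ->.
by have [j _] := tree_edge T wG wr; exact: joins_eset j.
Qed.

(** For this fixed program [time_bound] is a polynomial in the monomials n * n, n * M, n and M, each
    bounded separately since [lia] is linear; 1000 is a round number large enough for its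
    coefficients. The 1 added on the left is the assignment before the compiled program. *)
Lemma main_prog_time n M m : 0 < n -> n <= m.+1 -> M <= 2 * m ->
  time_bound main_prog n M + 1 <= 1000 * (m * n + 1).
Proof.
move=> n0 nm Mm.
have mn : m <= m * n by rewrite leq_pmulr.
have nn : n * n <= m * n + n by rewrite -mulSnr leq_mul2r nm orbT.
have nM : n * M <= 2 * (m * n) by rewrite mulnA [n * M]mulnC leq_mul2r Mm orbT.
have nm' : n <= m * n + 1 by rewrite addn1; apply: leq_trans nm _.
by rewrite /=; lia.
Qed.

(** Some input for the program, so that the mere existence of a sequence also follows from the
    algorithm. *)
Definition adjacency_list_from (G : graph) : adjacency_list :=
  [seq (v, [seq x <- [seq (e, w) | e <- eset G, w <- vset G] | joins G x.1 v x.2])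
  | v <- vset G].

Lemma adjacency_list_fromP G : adjacency_list_of G (adjacency_list_from G).
Proof.
have E : unzip1 (adjacency_list_from G) = vset G.
  by rewrite /unzip1 -map_comp map_id.
split; rewrite ?E ?fset_uniq //.
move=> v l /mapP[w _ [-> ->]]; split.
  apply/filter_uniq/allpairs_uniq; rewrite ?fset_uniq //.
  by move=> [? ?] [? ?] _ _.
move=> e z; rewrite mem_filter /=; apply: andb_idr => j.
by apply/allpairsP; exists (e, z); rewrite (joins_eset j) (joins_vset j).2.
Qed.

(** The leading assignment puts the last offset, which is the number of entries, into register 1; it
    stands outside the compiled program because well-formed programs do not write that register. *)
Lemma construction G L : three_edge_connected G -> adjacency_list_of G L ->
  exists v0 G0 s t st,
    [/\ topological_extension_sequence v0 G0 s G,
        exec (Seq (Assign 1 (Get aOff (Reg 0))) (compile main_prog))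
          (input_state L) t st,
        out st = sequence_code v0 s &
        t <= 1000 * (#|` eset G| * #|` vset G| + 1)].
Proof.
move=> G3 LG; have [root [S _ _ [G0 [t [ts Ot]]]]] := main_progP G3 LG.
set s := set_reg _ _ _ in S Ot.
have wf : well_formed main_prog by vm_compute.
have [k ex bk] := @compile_exec main_prog s wf.
exists root, G0, t, (1 + k), (run main_prog s); split=> //.
  by apply: ExecSeq ex; constructor.
apply: leq_trans (main_prog_time _ (spanning_tree_card (st_tree S)) (input_length LG)).
- by rewrite addnC leq_add2r (input_size LG); apply: bk.
- by rewrite cardfs_gt0; case: G3 => -[].
Qed.

Theorem theorem1p4 :
  (forall G : graph, three_edge_connected G ->
     exists (v0 : nat) (G0 : graph) (s : seq (extension * graph)),
       topological_extension_sequence v0 G0 s G)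
  /\
  (exists (P : cmd) (C : nat),
     forall (G : graph) (n m : nat) (L : adjacency_list),
       three_edge_connected G -> #|` vset G| = n -> #|` eset G| = m ->
       adjacency_list_of G L ->
       exists (v0 : nat) (G0 : graph) (s : seq (extension * graph))
              (t : nat) (st : state),
         [/\ topological_extension_sequence v0 G0 s G,
             exec P (input_state L) t st,
             out st = sequence_code v0 s &
             t <= C * (m * n + 1)]).
Proof.
split.
  move=> G G3; have [v0 [G0 [s [t [st [ts _ _ _]]]]]] :=
    construction G3 (adjacency_list_fromP G).
  by exists v0, G0, s.
exists (Seq (Assign 1 (Get aOff (Reg 0))) (compile main_prog)), 1000.
by move=> G n m L G3 <- <- LG; apply: construction.
Qed.
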